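(* Let each $f_i:\mathbb{R}^m\to\mathbb{R}$, $i\in\mathcal N=\{1,\dots,N\}$, be $\mathcal C^2$ and $\mu_i$-strongly convex with $l_i$-Lipschitz continuous gradient, and let $\mathcal G$ be a fixed, strongly connected and weight-balanced digraph on $\mathcal N$ with Laplacian $L\neq\mathbf 0$. Let $\alpha>0$, $\beta\in\mathbb R$, $\gamma>0$ be arbitrary constants and consider, for $i\in\mathcal N$, $$\dot x_i=-\alpha\nabla f_i(x_i)-\lambda_i+\beta u_i,\qquad \dot\lambda_i=-\gamma u_i,\qquad u_i=\sigma(t)\sum_{j=1}^N a_{ij}(x_j-x_i),$$ with any $x_i(0)\in\mathbb R^m$ and with $\lambda_i(0)\in\mathbb R^m$ such that $\sum_{i\in\mathcal N}\lambda_i(0)=\mathbf 0$. Suppose the (finite, possibly time-varying) coupling gain satisfies $\sigma(t)\ge\underline\sigma>0$ for a constant $\underline\sigma$ and $$\frac12-\sigma(t)\,|\nu_i|\,d^i>0,\qquad\forall i\in\mathcal N,$$ where $d^i$ is the in/out-degree of agent $i$ and $\nu_i$ is the IFP index of agent $i$ defined in the context. Then the states $(x(t),\lambda(t))$ converge exponentially to the optimal point $(x^*,\lambda^* )$.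
   Context: $x=\mathrm{col}(x_1,\dots,x_N)$, $\lambda=\mathrm{col}(\lambda_1,\dots,\lambda_N)$. $f_i$ is $\mu_i$-strongly convex ($\mu_i>0$) if $(\nabla f_i(x)-\nabla f_i(y))^T(x-y)\ge\mu_i\|x-y\|^2$ for all $x,y$. A digraph has no self-loops and adjacency matrix $\mathcal A=[a_{ij}]$ with $a_{ij}>0$ if $(j,i)$ is an edge and $a_{ij}=0$ otherwise; in-degree $d_{in}^i=\sum_j a_{ij}$, out-degree $d_{out}^i=\sum_j a_{ji}$; weight-balanced means $d_{in}^i=d_{out}^i=:d^i$ for all $i$; Laplacian $L=\mathrm{diag}\{d_{in}^1,\dots,d_{in}^N\}-\mathcal A$. The optimal point $(x^*,\lambda^* )$ is the unique equilibrium with $\sum_i\lambda_i^*=\mathbf 0$: $x_1^*=\dots=x_N^*$ equals the minimizer of $\sum_i f_i$, and $\lambda_i^*=-\alpha\nabla f_i(x_i^* )$. Exponential convergence means that there are constants $c,\epsilon>0$ with $\|\mathrm{col}(x(t)-x^*,\lambda(t)-\lambda^* )\|\le c\,\|\mathrm{col}(x(0)-x^*,\lambda(0)-\lambda^* )\|e^{-\epsilon t}$ for all $t\ge0$. The IFP index of agent $i$ is $$\nu_i=-\min_{\eta_i}\max_{x_i}\frac{\left\|\eta_i\left(\alpha\beta\nabla^2f_i(x_i)-\gamma I\right)-\frac\beta\gamma I\right\|^2}{4\left(\mu_i\eta_i\alpha-\frac1\gamma\right)}\le0,$$ with $\eta_i$ ranging over $\eta_i>\frac1{\mu_i\alpha\gamma}$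 and $x_i$ over $\mathbb R^m$ (the maximum read as a supremum), and $\|\cdot\|$ the induced 2-norm. *)

(* Defs.v *)
(* MathComp / MathComp-Analysis *)
From mathcomp Require Import all_boot all_order all_algebra.
From mathcomp Require Import all_classical all_reals all_analysis.

Set Implicit Arguments.
Unset Strict Implicit.
Unset Printing Implicit Defensive.

Import Order.TTheory GRing.Theory Num.Theory.
Import numFieldNormedType.Exports.

Local Open Scope classical_set_scope.
Local Open Scope ring_scope.

(** Points of R^m are row vectors, as required by the library's Jacobian.  The
    norm `|_| that the library puts on matrices is the max norm, so the
    Euclidean one is defined here. *)

Definition dot (R : realType) (m : nat) (u v : 'rV[R]_m) : R :=
  \sum_(k < m) u 0 k * v 0 k.

Definition norm2 (R : realType) (m : nat) (v : 'rV[R]_m) : R :=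
  Num.sqrt (dot v v).

(** [v *m M^T] is the transpose of the column vector [M *m v^T]. *)
Definition opnorm2 (R : realType) (m : nat) (M : 'M[R]_m) : R :=
  sup [set norm2 (v *m M^T) | v in [set v : 'rV[R]_m | norm2 v <= 1]].

Definition grad (R : realType) (m : nat) (f : 'rV[R]_m -> R) (x : 'rV[R]_m) :
    'rV[R]_m :=
  \row_(k < m) 'D_(delta_mx 0 k) f x.

Definition hessian (R : realType) (m : nat) (f : 'rV[R]_m -> R)
    (x : 'rV[R]_m) : 'M[R]_m :=
  jacobian (grad f) x.

Definition C2 (R : realType) (m : nat) (f : 'rV[R]_m -> R) : Prop :=
  [/\ forall x, differentiable f x,
      forall x, differentiable (grad f) x &
      continuous (hessian f)].

Definition strongly_convex (R : realType) (m : nat) (mu : R)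
    (f : 'rV[R]_m -> R) : Prop :=
  0 < mu /\
  forall x y, mu * norm2 (x - y) ^+ 2 <= dot (grad f x - grad f y) (x - y).

Definition lipschitz_grad (R : realType) (m : nat) (l : R)
    (f : 'rV[R]_m -> R) : Prop :=
  forall x y, norm2 (grad f x - grad f y) <= l * norm2 (x - y).

(** The outer minimum need not be attained (e.g. when alpha * beta * hessian f
    is constantly gamma * I and beta <> 0), hence [inf].  Both the [inf] and,
    when the gradient is Lipschitz, the [sup] are taken over nonempty bounded
    sets of reals. *)
Definition ifp_index (R : realType) (m : nat) (alpha beta gamma mu : R)
    (f : 'rV[R]_m -> R) : R :=
  - inf [set sup [set opnorm2 (eta *: ((alpha * beta) *: hessian f x - gamma%:M)
                               - (beta / gamma)%:M) ^+ 2
                      / (4 * (mu * eta * alpha - gamma^-1))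
                 | x in [set: 'rV[R]_m]]
        | eta in [set eta : R | (mu * alpha * gamma)^-1 < eta]].

(** [e j i] is the presence of the edge (j, i), along which agent i receives
    information from agent j. *)
Definition adjacency (R : realType) (N : nat) (e : rel 'I_N) (A : 'M[R]_N) :
    Prop :=
  forall i j, (e j i -> 0 < A i j) /\ (~~ e j i -> A i j = 0).

Definition strongly_connected (N : nat) (e : rel 'I_N) : Prop :=
  forall i j, connect e i j.

Definition in_degree (R : realType) (N : nat) (A : 'M[R]_N) (i : 'I_N) : R :=
  \sum_j A i j.

Definition out_degree (R : realType) (N : nat) (A : 'M[R]_N) (i : 'I_N) : R :=
  \sum_j A j i.

Definition weight_balanced (R : realType) (N : nat) (A : 'M[R]_N) : Prop :=
  forall i, in_degree A i = out_degree A i.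

Definition laplacian (R : realType) (N : nat) (A : 'M[R]_N) : 'M[R]_N :=
  diag_mx (\row_i in_degree A i) - A.

Definition coupling (R : realType) (N m : nat) (A : 'M[R]_N) (s : R)
    (x : 'I_N -> 'rV[R]_m) (i : 'I_N) : 'rV[R]_m :=
  s *: \sum_j A i j *: (x j - x i).

(** No regularity is imposed on the gain sigma.  As it may jump, a solution is
    continuous on [0, +oo[ and satisfies the equations at all positive times
    outside of some countable set. *)
Definition solution (R : realType) (N m : nat) (f : 'I_N -> 'rV[R]_m -> R)
    (A : 'M[R]_N) (alpha beta gamma : R) (sigma : R -> R)
    (x lambda : R -> 'I_N -> 'rV[R]_m) : Prop :=
  [/\ forall i, {within `[0, +oo[, continuous (fun t : R => x t i)},
      forall i, {within `[0, +oo[, continuous (fun t : R => lambda t i)} &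
      exists2 D : set R, countable D &
        forall t, 0 < t -> ~ D t -> forall i,
          let u := coupling A (sigma t) (x t) in
          is_derive t 1 (fun s : R => x s i)
            (- alpha *: grad (f i) (x t i) - lambda t i + beta *: u i) /\
          is_derive t 1 (fun s : R => lambda s i) (- gamma *: u i)].

Definition minimizer (R : realType) (m : nat) (f : 'rV[R]_m -> R)
    (z : 'rV[R]_m) : Prop :=
  forall y, f z <= f y.

Definition optimal_point (R : realType) (N m : nat)
    (f : 'I_N -> 'rV[R]_m -> R) (alpha : R)
    (xstar lstar : 'I_N -> 'rV[R]_m) : Prop :=
  exists z, [/\ minimizer (fun y => \sum_i f i y) z,
                forall i, xstar i = z &
                forall i, lstar i = - alpha *: grad (f i) (xstar i)].

Definition stack (R : realType) (N m : nat) (x : 'I_N -> 'rV[R]_m) :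
    'rV[R]_(N * m) :=
  mxvec (\matrix_(i < N) x i).

Definition state_error (R : realType) (N m : nat)
    (x lambda xstar lstar : 'I_N -> 'rV[R]_m) : R :=
  norm2 (row_mx (stack x - stack xstar) (stack lambda - stack lstar)).

(* Main.v *)
Require Import Defs.
From mathcomp Require Import all_boot all_order all_algebra.
From mathcomp Require Import all_classical all_reals all_analysis.
From mathcomp Require Import ring lra.
Import Order.TTheory GRing.Theory Num.Theory.
Import numFieldNormedType.Exports.
Local Open Scope ring_scope.

(** Put [y_i = alpha grad f_i(x_i) + lambda_i] and [r_i = |nu_i|].  The storage
    function
      [V_i = eta/2 |y_i|^2 - ((x_i - z).lambda_i + alpha (f_i(x_i) - f_i(z)))/gamma]
    satisfies [V_i' = (x_i - z).u_i + r_i |u_i|^2 - Q_i(y_i, u_i)], where [Q_i >= 0]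
    when [eta] realizes the infimum defining [nu_i], so that [sum_i V_i] does not
    increase.  The gain condition leaves no uniform margin, hence exponential
    decay needs more: [Q_i] dominates [c |y_i - omega_i u_i|^2] for some
    [omega_i < beta], and [x_i' = (beta - omega_i) u_i - (y_i - omega_i u_i)], so
    adding [d |x_i - z|^2 / (2 (beta - omega_i))] to [V_i] for a small [d > 0]
    provides the missing multiple of [sum_i (x_i - z).u_i <= 0].
    The infimum may fail to be attained, but compactness in [1 / eta] shows that
    then either [alpha beta hess f_i = gamma I], and [|x_i - z|^2 + K |y_i|^2] is a
    storage function, or [hess f_i = (mu_i + gamma/(alpha beta)) I], and the infimum
    is attained once [mu_i] is replaced by this larger constant. *)

Set Implicit Arguments.
Unset Strict Implicit.
Unset Printing Implicit Defensive.

(** * Quadratic forms *)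

Section Dot.
Variables (R : realType) (m : nat).
Implicit Types (u v w : 'rV[R]_m) (a : R).

(** The matrix M inside the norm defining nu_i depends on x_i, so completing the square in Q_i gives
    c |y_i - M u_i / (2c)|^2 with a moving centre, whereas omega_i must be constant. The other terms
    of the completed square, in hess f_i - mu_i and in 4 r_i c - M^2, also control (hess f_i - mu_i)
    u_i; up to that quantity M acts as a scalar, which yields omega_i unless it violates omega_i <
    beta. The gain is not assumed bounded: where r_i = 0, the condition at agent i does not restrict
    sigma. Hence |u_i|^2 enters only through r_i |u_i|^2, which is why omega_i = 0 is required when
    r_i = 0, and decay is measured by sigma times the disagreement, so that the rate does not depend
    on the values of sigma. The dissipation of a single agent does not see |x_i - z|^2. It is
    recovered from the whole network, by strong convexity, connectivity and the conserved sum of the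
    lambda_i. *)

Lemma dotC u v : dot u v = dot v u.
Proof. by apply: eq_bigr => k _; rewrite mulrC. Qed.

Lemma dotDl u v w : dot (u + v) w = dot u w + dot v w.
Proof. by rewrite /dot -big_split; apply: eq_bigr => k _; rewrite mxE mulrDl. Qed.

Lemma dotZl a u v : dot (a *: u) v = a * dot u v.
Proof. by rewrite /dot mulr_sumr; apply: eq_bigr => k _; rewrite mxE mulrA. Qed.

Lemma dotDr u v w : dot u (v + w) = dot u v + dot u w.
Proof. by rewrite dotC dotDl !(dotC u). Qed.

Lemma dotZr a u v : dot u (a *: v) = a * dot u v.
Proof. by rewrite dotC dotZl dotC. Qed.

Lemma dotNl u v : dot (- u) v = - dot u v.
Proof. by rewrite -scaleN1r dotZl mulN1r. Qed.

Lemma dotNr u v : dot u (- v) = - dot u v.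
Proof. by rewrite dotC dotNl dotC. Qed.

Lemma dot0l v : dot 0 v = 0.
Proof. by rewrite -(scale0r v) dotZl mul0r. Qed.

Lemma dot0r v : dot v 0 = 0.
Proof. by rewrite dotC dot0l. Qed.

Lemma dot_suml I (r : seq I) (P : pred I) (F : I -> 'rV[R]_m) v :
  dot (\sum_(i <- r | P i) F i) v = \sum_(i <- r | P i) dot (F i) v.
Proof.
elim/big_rec2: _ => [|i y x _ <-]; first exact: dot0l.
by rewrite dotDl.
Qed.

Lemma dot_sumr I (r : seq I) (P : pred I) (F : I -> 'rV[R]_m) v :
  dot v (\sum_(i <- r | P i) F i) = \sum_(i <- r | P i) dot v (F i).
Proof. by rewrite dotC dot_suml; apply: eq_bigr => i _; rewrite dotC. Qed.

Lemma dotBl u v w : dot (u - v) w = dot u w - dot v w.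
Proof. by rewrite dotDl dotNl. Qed.

Definition dotE := (dotDl, dotDr, dotNl, dotNr, dotZl, dotZr).

Lemma dot_ge0 v : 0 <= dot v v.
Proof. by apply: sumr_ge0 => k _; rewrite -expr2 sqr_ge0. Qed.

Lemma dot_eq0 v : dot v v = 0 -> v = 0.
Proof.
move/eqP; rewrite psumr_eq0 => [/allP h|k _]; last by rewrite -expr2 sqr_ge0.
apply/rowP => k; rewrite mxE; apply/eqP.
by have := h k (mem_index_enum _); rewrite mulf_eq0 orbb.
Qed.

Lemma norm2_ge0 v : 0 <= norm2 v. Proof. exact: sqrtr_ge0. Qed.

Lemma sqr_norm2 v : norm2 v ^+ 2 = dot v v.
Proof. by rewrite sqr_sqrtr ?dot_ge0. Qed.

Lemma young a u v : 0 < a -> 2 * dot u v <= a * dot u u + a^-1 * dot v v.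
Proof.
move=> a0; rewrite -subr_ge0.
have -> : a * dot u u + a^-1 * dot v v - 2 * dot u v
  = a * dot (u - a^-1 *: v) (u - a^-1 *: v).
  by rewrite !dotE (dotC v u); field; rewrite gt_eqF.
by rewrite mulr_ge0 ?dot_ge0 // ltW.
Qed.

Lemma cauchy_schwarz u v : dot u v ^+ 2 <= dot u u * dot v v.
Proof.
have [v0|v0] := eqVneq (dot v v) 0.
  by rewrite (dot_eq0 v0) !dot0r expr0n mulr0.
have vp : 0 < dot v v by rewrite lt_def v0 dot_ge0.
have := dot_ge0 (dot v v *: u - dot u v *: v); rewrite !dotE (dotC v u).
set a := dot u u; set b := dot u v; set c := dot v v => h.
have : 0 <= c * (a * c - b ^+ 2) by apply: le_trans h _; rewrite le_eqVlt; apply/orP; left; apply/eqP; ring.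
by rewrite pmulr_rge0 // subr_ge0.
Qed.

Lemma dot_le_norm2 u v : dot u v <= norm2 u * norm2 v.
Proof.
apply: le_trans (ler_norm _) _.
rewrite -ler_sqr ?nnegrE ?mulr_ge0 ?norm2_ge0 // exprMn !sqr_norm2.
by rewrite real_normK ?num_real // cauchy_schwarz.
Qed.

Lemma dotM u v (M : 'M[R]_m) : dot (u *m M) v = dot u (v *m M^T).
Proof.
rewrite /dot (eq_bigr (fun k => \sum_j u 0 j * M j k * v 0 k)); last first.
  by move=> k _; rewrite mxE mulr_suml.
rewrite exchange_big; apply: eq_bigr => j _ /=; rewrite mxE mulr_sumr.
by apply: eq_bigr => k _; rewrite mxE -mulrA (mulrC (M _ _)).
Qed.

Lemma dotMsym u v (M : 'M[R]_m) : M^T = M -> dot (u *m M) v = dot u (v *m M).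
Proof. by move=> Ms; rewrite dotM Ms. Qed.

Lemma dot_sqrD u v : dot (u + v) (u + v) <= 2 * dot u u + 2 * dot v v.
Proof.
have := dot_ge0 (u - v); rewrite !dotE (dotC v u).
by set a := dot u u; set b := dot u v; set c := dot v v => h; lra.
Qed.

Lemma dot_sqrB u v : dot (u - v) (u - v) <= 2 * dot u u + 2 * dot v v.
Proof. by apply: le_trans (dot_sqrD _ _) _; rewrite dotNl dotNr opprK. Qed.

(** Positivity of [P] at [B v - v P] and the upper bound at [v P] add up to [P^2 <= B P], with no
    recourse to eigenvalues or square roots. *)
Lemma psd_image (P : 'M[R]_m) (B : R) v : P^T = P -> 0 < B ->
  (forall w, 0 <= dot w (w *m P)) -> (forall w, dot w (w *m P) <= B * dot w w) ->
  dot (v *m P) (v *m P) <= B * dot v (v *m P).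
Proof.
move=> Ps B0 P0 PB; set w := v *m P.
have := P0 (B *: v - w); have := PB w.
rewrite mulmxBl -scalemxAl -/w !dotE => h1 h2.
have e : dot v (w *m P) = dot w w by rewrite -dotMsym.
rewrite e in h2; rewrite -(ler_pM2l B0).
by set a := dot w w in h1 h2 *; set b := dot v w in h2 *; lra.
Qed.

End Dot.

(** * Completed squares of a quadratic form in [y] and [u] *)

Section Form.
Variables (R : realType) (m : nat).
Implicit Types (y u v w : 'rV[R]_m).

(** With [s = 4 r c] and [G = s - M^2], completing the square gives [F = c |q|^2 + a y.(y E) + u.(u
    G) / (4 c)], three nonnegative terms. As [E] and [M] commute, [s u E = u G E + u M E M], and
    [u M = 2 c (y - q)] reduces the last term to [y E] and [q E]. [K] is chosen before [E], so the
    bounds are uniform when [E] is a shifted Hessian at a varying point. *)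
Lemma form_control (a b c m0 r La : R) :
  0 < a -> 0 < c -> 0 < r -> 0 < La ->
  exists2 K, 0 < K & forall E : 'M[R]_m, E^T = E ->
    (forall w, 0 <= dot w (w *m E)) ->
    (forall w, dot w (w *m E) <= La * dot w w) ->
    let M := m0%:M + b *: E in
    (forall w, dot (w *m M) (w *m M) <= 4 * r * c * dot w w) ->
    forall y u,
    let F := c * dot y y + a * dot y (y *m E) - dot y (u *m M) + r * dot u u in
    let q := y - (2 * c)^-1 *: (u *m M) in
    let g := (4 * r * c) *: u - u *m M *m M in
    [/\ dot (u *m E) (u *m E) <= K * F, dot q q <= K * F & dot g g <= K * F].
Proof.
move=> a0 c0 r0 L0.
pose s := 4 * r * c; have s0 : 0 < s by rewrite /s !mulr_gt0.
pose K1 := La ^+ 2 * (s * (4 * c)) .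
pose K2 := s * (8 * c ^+ 2 * (La / a + La ^+ 2 / c)).
pose K3 := s^-1 ^+ 2 * (2 * K1 + 2 * K2).
have K10 : 0 < K1 by rewrite /K1 !(mulr_gt0, exprn_gt0).
have K20 : 0 < K2 by rewrite /K2 !(mulr_gt0, exprn_gt0, addr_gt0, invr_gt0).
have K30 : 0 < K3 by rewrite /K3 !(mulr_gt0, exprn_gt0, addr_gt0, invr_gt0).
exists (K3 + c^-1 + s * (4 * c)) => [|E Es E0 EL M ML y u F q g].
  by rewrite !(addr_gt0, mulr_gt0, invr_gt0).
have Ms : M^T = M by rewrite /M linearD /= linearZ /= Es tr_scalar_mx.
have comm : E *m M = M *m E.
  by rewrite mulmxDr mulmxDl scalar_mxC -scalemxAr -scalemxAl.
have nE w : dot (w *m E) (w *m E) <= La * dot w (w *m E) by exact: psd_image.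
have nE2 w : dot (w *m E) (w *m E) <= La ^+ 2 * dot w w.
  by apply: le_trans (nE w) _; rewrite expr2 -mulrA ler_pM2l.
pose G := s%:M - M *m M.
have uG w : w *m G = s *: w - w *m M *m M.
  by rewrite /G mulmxBr mul_mx_scalar mulmxA.
have Gs : G^T = G by rewrite /G linearB /= tr_scalar_mx trmx_mul Ms.
have Gq w : dot w (w *m G) = s * dot w w - dot (w *m M) (w *m M).
  by rewrite uG !dotE -(dotMsym w (w *m M) Ms).
have G0 w : 0 <= dot w (w *m G) by rewrite Gq subr_ge0 ML.
have GB w : dot w (w *m G) <= s * dot w w.
  by rewrite Gq lerBlDr lerDl dot_ge0.
have nG : dot g g <= s * dot u (u *m G).
  by rewrite /g -uG; exact: psd_image.
have FE : F = c * dot q q + a * dot y (y *m E) + (4 * c)^-1 * dot u (u *m G).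
  rewrite Gq /F /q !dotE (dotC (u *m M) y) /s.
  by field; rewrite ?gt_eqF.
have q0 := dot_ge0 q; have yE0 := E0 y; have uG0 := G0 u.
have ci : 0 < (4 * c)^-1 by rewrite invr_gt0 mulr_gt0.
have t1 : 0 <= c * dot q q by rewrite mulr_ge0 // ltW.
have t2 : 0 <= a * dot y (y *m E) by rewrite mulr_ge0 // ltW.
have t3 : 0 <= (4 * c)^-1 * dot u (u *m G) by rewrite mulr_ge0 // ltW.
have F0 : 0 <= F by rewrite FE; lra.
have bq : dot q q <= c^-1 * F.
  by rewrite -(ler_pM2l c0) mulrA mulfV ?gt_eqF // mul1r FE; lra.
have bE : dot y (y *m E) <= a^-1 * F.
  by rewrite -(ler_pM2l a0) mulrA mulfV ?gt_eqF // mul1r FE; lra.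
have bG : dot u (u *m G) <= 4 * c * F.
  rewrite -(ler_pM2l ci) mulrA mulVf ?gt_eqF ?mulr_gt0 // mul1r FE; lra.
have bg : dot g g <= s * (4 * c) * F.
  by apply: le_trans nG _; rewrite -mulrA ler_pM2l.
have uM : u *m M = (2 * c) *: (y - q).
  by rewrite /q opprB addrC subrK scalerA mulfV ?scale1r // gt_eqF // mulr_gt0.
have dec : s *: (u *m E) = u *m G *m E + u *m M *m E *m M.
  have e : u *m M *m M *m E = u *m M *m E *m M by rewrite -[LHS]mulmxA -comm mulmxA.
  by rewrite uG mulmxBl e subrK scalemxAl.
have b1 : dot (u *m G *m E) (u *m G *m E) <= K1 * F.
  apply: le_trans (nE2 _) _; rewrite /K1 -mulrA ler_pM2l ?exprn_gt0 //.
  by rewrite uG.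
have b2 : dot (u *m M *m E *m M) (u *m M *m E *m M) <= K2 * F.
  apply: le_trans (ML _) _; rewrite /K2 -/s -mulrA ler_pM2l //.
  rewrite uM -scalemxAl mulmxBl !dotE.
  have := dot_sqrB (y *m E) (q *m E); rewrite !dotE.
  have := nE y; have := nE2 q.
  have : La ^+ 2 * dot q q <= La ^+ 2 / c * F by rewrite -mulrA ler_pM2l ?exprn_gt0.
  have : La * dot y (y *m E) <= La / a * F by rewrite -mulrA ler_pM2l.
  rewrite (dotC (q *m E)).
  set A1 := dot (y *m E) (y *m E); set A2 := dot (y *m E) (q *m E).
  set A4 := dot (q *m E) (q *m E); set B1 := La / a; set B2 := _ / c => e1 e2 e3 e4 e5.
  have e6 : A1 - A2 + (- A2 + A4) <= 2 * (B1 + B2) * F by lra.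
  have c2 : 0 < c ^+ 2 by rewrite exprn_gt0.
  by have := ler_wpM2l (ltW c2) e6; lra.
split.
- have : s ^+ 2 * dot (u *m E) (u *m E) <= (2 * K1 + 2 * K2) * F.
    have := dot_sqrD (u *m G *m E) (u *m M *m E *m M).
    by rewrite -dec !dotE mulrA -expr2; lra.
  have K3e : K3 * F = s^-1 ^+ 2 * ((2 * K1 + 2 * K2) * F) by rewrite /K3; ring.
  move=> h; have : dot (u *m E) (u *m E) <= K3 * F.
    rewrite K3e -(ler_pM2l (exprn_gt0 2 s0)) mulrA exprVn mulfV ?mul1r //.
    by rewrite gt_eqF ?exprn_gt0.
  have : 0 <= c^-1 * F by rewrite mulr_ge0 // ltW ?invr_gt0.
  have : 0 <= s * (4 * c) * F by rewrite !mulr_ge0 // ltW.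
  by rewrite !mulrDl; lra.
- have : 0 <= K3 * F by rewrite mulr_ge0 // ltW.
  have : 0 <= s * (4 * c) * F by rewrite !mulr_ge0 // ltW.
  by rewrite !mulrDl; lra.
- have : 0 <= K3 * F by rewrite mulr_ge0 // ltW.
  have : 0 <= c^-1 * F by rewrite mulr_ge0 // ltW ?invr_gt0.
  by rewrite !mulrDl; lra.
Qed.
End Form.

(** * Dissipation of a single agent *)

Section AgentForm.
Variables (R : realType) (m : nat) (X : Type) (H : X -> 'M[R]_m).
Variables (alpha beta gamma mu l r : R) (x0 : X) (v0 : 'rV[R]_m).
Hypotheses (alpha0 : 0 < alpha) (gamma0 : 0 < gamma) (mu0 : 0 < mu).
Hypotheses (r0 : 0 <= r) (v0_neq0 : v0 != 0).
Hypothesis Hsym : forall x, (H x)^T = H x.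
Hypothesis Hmu : forall x v, mu * dot v v <= dot v (v *m H x).
Hypothesis Hl : forall x v, dot v (v *m H x) <= l * dot v v.

(** The matrix inside the norm of the IFP index, applied to [u]. *)
Definition supply eta (x : X) (u : 'rV[R]_m) : 'rV[R]_m :=
  (eta * alpha * beta) *: (u *m H x) - (eta * gamma + beta / gamma) *: u.

(** The form [Q_i] of the overview, [H] being the Hessian. *)
Definition dissipation eta (x : X) (y u : 'rV[R]_m) : R :=
  eta * alpha * dot y (y *m H x) - gamma^-1 * dot y y - dot y (supply eta x u)
    + r * dot u u.

Let nv0 : 0 < dot v0 v0.
Proof. by rewrite lt_def dot_ge0 andbT; apply: contra_neq v0_neq0 => /dot_eq0. Qed.

Let l0 : 0 < l.
Proof.
have := le_trans (Hmu x0 v0) (Hl x0 v0); rewrite ler_pM2r // => h.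
exact: lt_le_trans h.
Qed.

(** With [r = 0] the supply vanishes, so [eta alpha beta H = (eta gamma + beta / gamma) I]. If
    [beta <= 0], the bound [H >= mu] would turn this into [eta gamma <= (eta mu alpha - 1 / gamma)
    beta <= 0]. *)
Lemma dissipation_r0 eta : gamma^-1 < eta * mu * alpha -> r = 0 ->
  (forall x v, dot (supply eta x v) (supply eta x v) <=
               4 * r * (eta * mu * alpha - gamma^-1) * dot v v) ->
  0 < beta /\ forall x y u, (eta * mu * alpha - gamma^-1) * dot y y
     <= dissipation eta x y u.
Proof.
move=> he rz hM; have M0 x v : supply eta x v = 0.
  apply/dot_eq0/eqP; rewrite eq_le dot_ge0 andbT; apply: le_trans (hM _ _) _.
  by rewrite rz mulr0 !mul0r.
have gi : 0 < gamma^-1 by rewrite invr_gt0.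
have eta0 : 0 < eta.
  have : 0 < eta * mu * alpha by lra.
  by rewrite !pmulr_lgt0.
split=> [|x y u].
  rewrite ltNge; apply/negP => b0.
  have := congr1 (dot v0) (M0 x0 v0); rewrite /supply dot0r !dotE.
  set A := dot v0 (_ *m _); set B := dot v0 v0 => e.
  have h1 := Hmu x0 v0; rewrite -/A -/B in h1.
  have h2 : eta * alpha * beta * A <= eta * alpha * beta * (mu * B).
    apply: ler_wnM2l => //; rewrite pmulr_rle0 // mulr_gt0 //.
  have h3 : (eta * mu * alpha - gamma^-1) * beta <= 0.
    by rewrite pmulr_rle0 // subr_gt0.
  have h4 : 0 < eta * gamma * B by rewrite !mulr_gt0.
  have h5 : (eta * mu * alpha - gamma^-1) * beta * B <= 0.
    by rewrite pmulr_lle0.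
  by move: h2 e h5; lra.
rewrite /dissipation M0 dot0r rz mul0r subr0 addr0 mulrBl lerB //.
by rewrite [eta * mu * alpha]mulrAC -(mulrA (eta * alpha)) ler_pM2l ?Hmu ?mulr_gt0.
Qed.

(** The natural centre [m0 / (2 c)] is below [beta] exactly when [beta c + eta gamma > 0]. Otherwise
    either [u] itself is controlled, and any [omega] will do, or the Hessian is the constant [mu],
    and [eta] has to be changed. *)
Lemma dissipation_ge eta : gamma^-1 < eta * mu * alpha ->
  (forall x v, dot (supply eta x v) (supply eta x v) <=
               4 * r * (eta * mu * alpha - gamma^-1) * dot v v) ->
  exists eta' omega c : R,
    [/\ gamma^-1 < eta' * mu * alpha, omega < beta, 0 < c, (r = 0 -> omega = 0) &
        forall x y u, c * dot (y - omega *: u) (y - omega *: u)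
                      <= dissipation eta' x y u].
Proof.
move=> he hM; set c := eta * mu * alpha - gamma^-1 in hM *.
have c0 : 0 < c by rewrite subr_gt0.
have gi : 0 < gamma^-1 by rewrite invr_gt0.
have eta0 : 0 < eta.
  have : 0 < eta * mu * alpha by lra.
  by rewrite !pmulr_lgt0.
have [rz|rn] := eqVneq r 0.
  have [b0 hF] := dissipation_r0 he rz hM.
  exists eta, 0, c; split => // x y u; rewrite scale0r subr0; exact: hF.
have rp : 0 < r by rewrite lt_def rn.
pose a := eta * alpha; pose b := eta * alpha * beta.
(* [m0] and [b] are the coefficients of the supply matrix on [I] and on [E = H - mu]. *)
pose m0 := beta * c - eta * gamma.
have a0 : 0 < a by rewrite mulr_gt0.
have [K K0 HK] := form_control m b m0 a0 c0 rp l0.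
pose E x := H x - mu%:M.
have Es x : (E x)^T = E x by rewrite linearB /= Hsym tr_scalar_mx.
have Ev x (w : 'rV[R]_m) : w *m E x = w *m H x - mu *: w by rewrite mulmxBr mul_mx_scalar.
have Eq x w : dot w (w *m E x) = dot w (w *m H x) - mu * dot w w by rewrite Ev !dotE.
have E0 x w : 0 <= dot w (w *m E x) by rewrite Eq subr_ge0.
have EL x w : dot w (w *m E x) <= l * dot w w.
  by rewrite Eq; have := Hl x w; have := mulr_ge0 (ltW mu0) (dot_ge0 w); lra.
have Mv x w : w *m (m0%:M + b *: E x) = supply eta x w.
  rewrite mulmxDr mul_mx_scalar -scalemxAr Ev /supply scalerBr scalerA.
  rewrite addrCA; congr (_ + _); rewrite -scalerBl -[RHS]scaleNr; congr (_ *: _).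
  by rewrite /m0 /b /c; ring.
have FE x y u : c * dot y y + a * dot y (y *m E x) - dot y (supply eta x u) + r * dot u u
   = dissipation eta x y u.
  by rewrite /dissipation Eq /c /a; ring.
have ML x w : dot (w *m (m0%:M + b *: E x)) (w *m (m0%:M + b *: E x)) <=
   4 * r * c * dot w w by rewrite Mv hM.
have {}HK x y u : _ := HK (E x) (Es x) (E0 x) (EL x) (ML x) y u.
have F0 x y u : 0 <= dissipation eta x y u.
  have [h _ _] := HK x y u; rewrite Mv FE in h.
  by have := le_trans (dot_ge0 _) h; rewrite pmulr_rge0.
pose om := m0 / (2 * c).
pose k := b / (2 * c).
have pE x (y u : 'rV[R]_m) : y - om *: u = (y - (2 * c)^-1 *: (u *m (m0%:M + b *: E x))) + k *: (u *m E x).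
  rewrite mulmxDr mul_mx_scalar -scalemxAr scalerDr !scalerA opprD addrA.
  by rewrite /om /k [b / _]mulrC addrNK (mulrC m0).
pose K1 := (2 + 2 * k ^+ 2) * K.
have K10 : 0 < K1.
  by rewrite mulr_gt0 // ltr_pwDl // mulr_ge0 // sqr_ge0.
have pK x (y u : 'rV[R]_m) : dot (y - om *: u) (y - om *: u) <= K1 * dissipation eta x y u.
  have [h1 h2 _] := HK x y u; rewrite (pE x); apply: le_trans (dot_sqrD _ _) _.
  rewrite !dotE mulrA -expr2; rewrite !(Mv, FE) in h1 h2 *.
  have := ler_wpM2l (sqr_ge0 k) h1; rewrite /K1.
  by move: h2; rewrite !dotE; lra.
have [kp|kn] := ltP 0 (beta * c + eta * gamma).
  exists eta, om, K1^-1; split=> //; rewrite ?invr_gt0 //.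
  - rewrite /om ltr_pdivrMr ?mulr_gt0 // /m0; lra.
  - by move=> z; rewrite z eqxx in rn.
  - by move=> x y u; rewrite -(ler_pM2l K10) mulrA mulfV ?mul1r ?gt_eqF.
have b0 : beta < 0.
  rewrite ltNge; apply/negP => bb; have : 0 <= beta * c by rewrite mulr_ge0 // ltW.
  by have := mulr_gt0 eta0 gamma0; lra.
have bn : b < 0 by rewrite pmulr_rlt0 // mulr_gt0.
have mn : m0 < 0.
  have : beta * c < 0 by rewrite pmulr_llt0.
  by have := mulr_gt0 eta0 gamma0; rewrite /m0; lra.
(* Expanding [M^2] gives [d u = (4 r c u - u M^2) + 2 m0 b u E + b^2 u E^2]. All terms on the right
   are controlled, hence so is [u] when [d] is nonzero. *)
pose d := 4 * r * c - m0 ^+ 2.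
have [dz|dn] := eqVneq d 0; last first.
  have dd : 0 < d ^+ 2 by rewrite lt_def sqr_ge0 expf_neq0.
  pose K2 := (d ^+ 2)^-1 * (2 * K + 2 * (2 * ((2 * m0 * b) ^+ 2 * K) + 2 * (b ^+ 2 ^+ 2 * (l * (l * K))))).
  have lE x w : dot (w *m E x) (w *m E x) <= l * (l * dot w w).
    have := psd_image w (Es x) l0 (E0 x) (EL x); have := EL x w.
    by rewrite -(ler_pM2l l0); lra.
  have uK x (y u : 'rV[R]_m) : dot u u <= K2 * dissipation eta x y u.
    have [h1 _ h3] := HK x y u; rewrite !(Mv, FE) in h1 h3.
    have e : d *: u = ((4 * r * c) *: u - supply eta x (supply eta x u)) +
        ((2 * m0 * b) *: (u *m E x) + b ^+ 2 *: (u *m E x *m E x)).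
      have SM (w : 'rV[R]_m) : supply eta x w = m0 *: w + b *: (w *m E x).
        by rewrite -Mv mulmxDr mul_mx_scalar -scalemxAr.
      rewrite !SM mulmxDl -!scalemxAl.
      move: (u *m E x) (u *m E x *m E x) => p q.
      by apply/rowP => k0; rewrite !mxE /d; ring.
    have h2 : dot (u *m E x *m E x) (u *m E x *m E x) <= l * (l * K) * dissipation eta x y u.
      by apply: le_trans (lE _ _) _; rewrite -!mulrA !ler_pM2l.
    rewrite /K2 -[X in _ <= X]mulrA ler_pdivlMl //.
    have -> : d ^+ 2 * dot u u = dot (d *: u) (d *: u) by rewrite !dotE; ring.
    rewrite e; apply: le_trans (dot_sqrD _ _) _.
    have := dot_sqrD ((2 * m0 * b) *: (u *m E x)) (b ^+ 2 *: (u *m E x *m E x)).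
    rewrite ![dot (_ *: _) (_ *: _)]dotZl ![dot _ (_ *: _)]dotZr.
    have := ler_wpM2l (sqr_ge0 (2 * m0 * b)) h1.
    have := ler_wpM2l (sqr_ge0 (b ^+ 2)) h2.
    by move: h3; lra.
  pose om' := beta - 1.
  pose K3 := 2 * K1 + 2 * ((om - om') ^+ 2 * K2).
  have K20 : 0 <= K2.
    by rewrite !(ltW l0, ltW K0, sqr_ge0, mulr_ge0, addr_ge0, invr_ge0).
  have K30 : 0 < K3.
    apply: ltr_pwDl; first by rewrite mulr_gt0.
    by rewrite mulr_ge0 // mulr_ge0 // sqr_ge0.
  exists eta, om', K3^-1; split=> //; rewrite ?invr_gt0 //; first by rewrite /om'; lra.
    by move=> z; rewrite z eqxx in rn.
  move=> x y u; rewrite -(ler_pM2l K30) mulrA mulfV ?mul1r ?gt_eqF //.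
  have -> : y - om' *: u = (y - om *: u) + (om - om') *: u.
    by rewrite [(om - om') *: u]scalerBl addrA addrNK.
  apply: le_trans (dot_sqrD _ _) _; rewrite ![dot (_ *: _) (_ *: _)]dotZl ![dot _ (_ *: _)]dotZr.
  have := pK x y u; have := ler_wpM2l (sqr_ge0 (om - om')) (uK x y u); rewrite /K3.
  lra.
(* When the Hessian is the constant mu, only the minimizer over eta of the
   quotient defining the index yields a suitable omega. *)
have Ez x (v : 'rV[R]_m) : v *m H x = mu *: v.
  suff : v *m E x = 0 by rewrite Ev => /eqP; rewrite subr_eq0 => /eqP.
  apply/dot_eq0/eqP.
  rewrite eq_le dot_ge0 andbT.
  apply: le_trans (psd_image v (Es x) l0 (E0 x) (EL x)) _.
  (* With [4 r c = m0^2], the bound on [M^2] reads [2 m0 b v.(v E) + b^2 |v E|^2 <= 0]; as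
     [m0 b > 0], this forces [E] to vanish. *)
  rewrite pmulr_rle0 //; have := ML x v.
  rewrite mulmxDr mul_mx_scalar -scalemxAr !dotE (dotC (v *m E x) v).
  have : 0 <= b * (b * dot (v *m E x) (v *m E x)).
    by rewrite mulrA -expr2 mulr_ge0 ?sqr_ge0 ?dot_ge0.
  have -> : 4 * r * c = m0 ^+ 2 by apply/eqP; rewrite -subr_eq0 -/d dz.
  move=> h1 h2; have h3 : (m0 * b) * dot v (v *m E x) <= 0 by lra.
  by rewrite -(@pmulr_rle0 _ (m0 * b)) // nmulr_rgt0.
pose D := alpha * mu; have D0 : 0 < D by rewrite mulr_gt0.
pose P := gamma / D - beta; pose Q := D^-1.
have Q0 : 0 < Q by rewrite invr_gt0.
have P0 : 0 < P by rewrite /P subr_gt0; apply: lt_trans b0 _; rewrite divr_gt0.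
have mE : m0 = - (P * c + Q).
  have -> : c = eta * D - gamma^-1 by rewrite /c /D; ring.
  by rewrite /m0 /P /Q /c /D; field; rewrite !gt_eqF.
(* The quotient of the index is now [(P c + Q)^2 / (4 c)], at least [P Q] with equality at
   [c1 = Q / P]. There the centre [m0 / (2 c)] becomes [- P], which is below [beta]. *)
have rPQ : P * Q <= r.
  have : 4 * r * c = (P * c + Q) ^+ 2.
    by rewrite -sqrrN -mE; apply/eqP; rewrite -subr_eq0 -/d dz.
  have := sqr_ge0 (P * c - Q) => h1 h2; rewrite -(ler_pM2r c0).
  move: h1 h2; rewrite !expr2; lra.
pose c1 := Q / P; have c10 : 0 < c1 by rewrite divr_gt0.
pose eta1 := (c1 + gamma^-1) / D.
have e1 : eta1 * mu * alpha = c1 + gamma^-1.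
  by rewrite /eta1 -mulrA (mulrC mu) -/D divfK // gt_eqF.
exists eta1, (- P), c1; split => //.
- by rewrite e1; lra.
- by have := divr_gt0 gamma0 D0; rewrite /P; lra.
- by move=> z; rewrite z eqxx in rn.
move=> x y u; rewrite /dissipation /supply !Ez !dotE.
have -> : eta1 * alpha * (mu * dot y y) = (c1 + gamma^-1) * dot y y by rewrite -e1; ring.
have -> : eta1 * alpha * beta * (mu * dot y u) = (c1 + gamma^-1) * beta * dot y u.
  by rewrite -e1; ring.
rewrite (dotC u y).
have -> : eta1 * gamma = c1 * beta + 2 * Q.
  rewrite /eta1 /c1 /Q /P; field; rewrite !gt_eqF // mulNr subr_gt0.
  by apply: lt_trans gamma0; rewrite pmulr_llt0.
have c1P : c1 * P = Q by rewrite /c1 divfK // gt_eqF.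
have : 0 <= (r - P * Q) * dot u u by rewrite mulr_ge0 ?dot_ge0 // subr_ge0.
set A := dot y y; set B := dot y u; set C := dot u u; rewrite -c1P; lra.
Qed.

End AgentForm.

(** * Gradients and Hessians *)

Section Calculus.
Local Open Scope classical_set_scope.
Variable R : realType.

Lemma is_derive_comp_diff (V W : normedModType R) (g : V -> W) (x : R -> V) (t : R) (dx : V) :
  differentiable g (x t) -> is_derive t 1 x dx ->
  is_derive t 1 (fun s => g (x s)) ('d g (x t) dx).
Proof.
move=> dg [dfx <-]; have dx' : differentiable x t by exact/derivable1_diffP.
have dgx := differentiable_comp dx' dg.
apply: DeriveDef; first exact: diff_derivable.
by rewrite deriveE // (diff_comp dx' dg) deriveE.
Qed.

Lemma is_derive_coord m (a : R -> 'rV[R]_m) (t : R) da k :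
  is_derive t 1 a da -> is_derive t 1 (fun s => a s 0 k) (da 0 k).
Proof.
move=> [da1 <-]; apply: DeriveDef; first exact: ((derivable_mxP _ _ _).1 da1).
by rewrite derive_mx // mxE.
Qed.

Lemma is_derive_dot m (a b : R -> 'rV[R]_m) (t : R) da db :
  is_derive t 1 a da -> is_derive t 1 b db ->
  is_derive t 1 (fun s => dot (a s) (b s)) (dot da (b t) + dot (a t) db).
Proof.
move=> ha hb.
have h k : is_derive t 1 (fun s => a s 0 k * b s 0 k) (a t 0 k *: db 0 k + b t 0 k *: da 0 k).
  by apply: is_deriveM; exact: is_derive_coord.
have := is_derive_sum h; rewrite fct_sumE => h2.
apply: is_derive_eq h2 _; rewrite /dot -big_split; apply: eq_bigr => k _ /=.
by rewrite addrC /GRing.scale /= (mulrC (b t 0 k)).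
Qed.

Lemma diff_grad m (f : 'rV[R]_m -> R) x v :
  differentiable f x -> 'd f x v = dot (grad f x) v.
Proof.
move=> df; rewrite {1}(row_sum_delta v) linear_sum /=; apply: eq_bigr => k _.
by rewrite linearZ /= mxE -deriveE // mulrC.
Qed.

Lemma diff_hessian m (f : 'rV[R]_m -> R) x v :
  differentiable (grad f) x -> 'd (grad f) x v = v *m hessian f x.
Proof. by move=> dg; rewrite -deriveE // deriveEjacobian. Qed.

Lemma is_derive_along m (f : 'rV[R]_m -> R) (x : R -> 'rV[R]_m) (t : R) dx :
  differentiable f (x t) -> is_derive t 1 x dx ->
  is_derive t 1 (fun s => f (x s)) (dot (grad f (x t)) dx).
Proof. by move=> df hx; rewrite -diff_grad //; exact: is_derive_comp_diff. Qed.

Lemma is_derive_grad m (f : 'rV[R]_m -> R) (x : R -> 'rV[R]_m) (t : R) dx :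
  differentiable (grad f) (x t) -> is_derive t 1 x dx ->
  is_derive t 1 (fun s => grad f (x s)) (dx *m hessian f (x t)).
Proof. by move=> df hx; rewrite -diff_hessian //; exact: is_derive_comp_diff. Qed.

Lemma is_derive_line m (x v : 'rV[R]_m) (t : R) :
  is_derive t 1 (fun s : R => x + s *: v) v.
Proof.
have h : is_derive t 1 (fun s : R => s *: v) v.
  by apply: DeriveDef; [exact/derivable1_diffP | rewrite deriveE // diff_val /= scale1r].
by have := is_deriveD (is_derive_cst x t 1) h; rewrite add0r.
Qed.

End Calculus.

(** * Symmetry of the Hessian *)

Section Hessian.
Variables (R : realType) (m : nat).
Implicit Types (f : 'rV[R]_m -> R) (x u v : 'rV[R]_m).

(** The topology of row vectors comes from the max norm; pairing it with the l1 norm transfers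
    little-o estimates to [dot]. *)
Lemma dot_le_max_norm u v : `|dot u v| <= `|u| * \sum_k `|v 0 k|.
Proof.
apply: le_trans (ler_norm_sum _ _ _) _; rewrite mulr_sumr.
apply: ler_sum => k _; rewrite normrM ler_wpM2r //.
by rewrite [X in _ <= X]/Num.Def.normr /= mx_normrE (le_bigmax _ _ (ord0, k)).
Qed.

Lemma grad_expansion f x v : differentiable (grad f) x -> forall e : R, 0 < e ->
  exists2 d : R, 0 < d & forall h : 'rV[R]_m, `|h| < d ->
    `|dot (grad f (x + h)) v - dot (grad f x) v - dot (h *m hessian f x) v| <= e * `|h|.
Proof.
move=> dg e e0; pose N := \sum_k `|v 0 k|.
have N0 : 0 <= N by apply: sumr_ge0.
have e1 : 0 < e / (N + 1) by rewrite divr_gt0 // ltr_wpDl.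
have /eqaddoP/(_ _ e1) := diff_locally dg.
move=> /nbhs_ballP[d /= d0 hd]; exists d => // h hh.
have /hd /= : ball 0 d h by rewrite -ball_normE /= sub0r normrN.
have -> : ((grad f \o shift x) - (cst (grad f x) + 'd (grad f) x)) h =
   grad f (x + h) - (grad f x + h *m hessian f x).
  by rewrite -diff_hessian //= [x + h]addrC.
rewrite -!dotBl => hb; apply: le_trans (dot_le_max_norm _ _) _.
rewrite -/N -addrA -opprD; apply: le_trans (ler_wpM2r N0 hb) _.
rewrite mulrAC ler_wpM2r // mulrAC ler_pdivrMr ?ltr_wpDl //.
by rewrite ler_pM2l // lerDl.
Qed.

(** The mean value theorem for [t |-> f (x + s u + t v) - f (x + t v)] on [[0, s]] leaves a
    difference of two gradients, and the expansion of the gradient at [x] applies to both. [B] adds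
    up the two displacements. *)
Lemma second_difference f x u v :
  (forall w, differentiable f w) -> differentiable (grad f) x ->
  forall e : R, 0 < e -> exists2 d : R, 0 < d & forall s, 0 < s -> s < d ->
    `|f (x + s *: u + s *: v) - f (x + s *: u) - f (x + s *: v) + f x
      - s ^+ 2 * dot (u *m hessian f x) v| <= e * s ^+ 2.
Proof.
move=> df dg e e0; pose B := `|u| + `|v| + `|v|.
have B0 : 0 <= B by rewrite !addr_ge0.
have B1 : 0 < B + 1 by rewrite ltr_wpDl.
have [d d0 hd] := grad_expansion v dg (divr_gt0 e0 B1).
exists (d / (B + 1)) => [|s s0 sd]; first by rewrite divr_gt0.
pose phi t := f (x + s *: u + t *: v) - f (x + t *: v).
pose dphi t := dot (grad f (x + s *: u + t *: v)) v - dot (grad f (x + t *: v)) v.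
have hphi (t : R) : is_derive t 1 phi (dphi t).
  by apply: is_deriveB; apply: is_derive_along => //; exact: is_derive_line.
have cphi : {within `[0, s], continuous phi}%classic.
  by apply: derivable_within_continuous => t _; exact: ex_derive.
have [t + Et] := MVT s0 (fun t _ => hphi t) cphi.
rewrite in_itv /= => /andP[t0 ts].
have -> : f (x + s *: u + s *: v) - f (x + s *: u) - f (x + s *: v) + f x = phi s - phi 0.
  rewrite /phi scale0r !addr0; ring.
rewrite Et subr0 {Et}.
have sBd : s * (B + 1) < d by rewrite -ltr_pdivlMr.
have nb (h : 'rV[R]_m) : `|h| <= s * B -> `|h| < d.
  by move=> hb; apply: le_lt_trans hb (lt_trans _ sBd); rewrite ltr_pM2l // ltrDl.
have tv : `|t *: v| <= s * `|v| by rewrite normrZ gtr0_norm // ler_wpM2r // ltW.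
have su : `|s *: u| = s * `|u| by rewrite normrZ gtr0_norm.
have h1 : `|s *: u + t *: v| <= s * (`|u| + `|v|).
  by apply: le_trans (ler_normD _ _) _; rewrite su mulrDr lerD2l.
have sv0 : 0 <= s * `|v| by rewrite mulr_ge0 // ltW.
have su0 : 0 <= s * `|u| by rewrite mulr_ge0 // ltW.
have := hd (s *: u + t *: v) (nb _ (le_trans h1 _)).
have -> : s * (`|u| + `|v|) <= s * B by rewrite ler_pM2l // /B lerDl.
move/(_ isT); have := hd (t *: v) (nb _ (le_trans tv _)).
have -> : s * `|v| <= s * B by rewrite ler_pM2l // /B lerDr addr_ge0.
move/(_ isT); rewrite /dphi addrA mulmxDl dotDl -(scalemxAl s) dotZl.
set G1 := dot (grad _ (x + _ + _)) v; set G2 := dot (grad _ (x + _)) v; set G0 := dot (grad _ x) v.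
set D1 := dot (u *m _) v; set D2 := dot (t *: v *m _) v => k2 k1.
set ee := e / (B + 1) in k1 k2.
have ee0 : 0 < ee by rewrite divr_gt0.
have -> : (G1 - G2) * s - s ^+ 2 * D1 = ((G1 - G0 - (s * D1 + D2)) - (G2 - G0 - D2)) * s by ring.
rewrite normrM (gtr0_norm s0) expr2 mulrA ler_pM2r //.
apply: le_trans (ler_normB _ _) _.
have : ee * `|s *: u + t *: v| + ee * `|t *: v| <= ee * (s * B).
  by rewrite -mulrDr ler_pM2l //; apply: le_trans (lerD h1 tv) _; rewrite /B !mulrDr.
have : ee * (s * B) <= e * s.
  rewrite mulrA mulrAC ler_pM2r // /ee mulrAC ler_pdivrMr // ler_pM2l // lerDl //.
by move=> k3 k4; apply: le_trans k3; apply: le_trans k4; exact: lerD.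
Qed.

(** The second difference is symmetric in [u] and [v], hence so is the bilinear form that it
    approximates. *)
Lemma hessian_sym f x :
  (forall w, differentiable f w) -> differentiable (grad f) x ->
  (hessian f x)^T = hessian f x.
Proof.
move=> df dg; have key u v : dot (u *m hessian f x) v = dot (v *m hessian f x) u.
  apply/eqP; rewrite -subr_eq0 -normr_eq0 eq_le normr_ge0 andbT.
  apply/ler_addgt0Pr => e e0; rewrite add0r.
  have e2 : 0 < e / 2 by rewrite divr_gt0.
  have [d1 d10 h1] := second_difference u v df dg e2.
  have [d2 d20 h2] := second_difference v u df dg e2.
  pose s := Num.min d1 d2 / 2.
  have s0 : 0 < s by rewrite divr_gt0 // lt_min d10.
  have sm : s < Num.min d1 d2 by rewrite ltr_pdivrMr // ltr_pMr ?ltr1n // lt_min d10.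
  move: sm; rewrite lt_min => /andP[sd1 sd2].
  have := h1 s s0 sd1; have := h2 s s0 sd2.
  rewrite (addrAC x).
  set f1 := f (x + _ + _); set f2 := f (x + s *: u); set f3 := f (x + s *: v).
  set A := dot (u *m _) v; set B := dot (v *m _) u => k1 k2.
  have s2 : 0 < s ^+ 2 by rewrite exprn_gt0.
  rewrite -(ler_pM2l s2) -{1}(gtr0_norm s2) -normrM.
  have -> : s ^+ 2 * (A - B) = (f1 - f3 - f2 + f x - s ^+ 2 * B) -
     (f1 - f2 - f3 + f x - s ^+ 2 * A) by ring.
  apply: le_trans (ler_normB _ _) _; apply: le_trans (lerD k1 k2) _.
  by rewrite -mulrDl -splitr mulrC.
apply/matrixP => i j; rewrite mxE.
have dd (M : 'M[R]_m) i' j' : dot (delta_mx 0 i' *m M) (delta_mx 0 j') = M i' j'.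
  rewrite -rowE /dot (bigD1 j') //= big1 => [|k kj]; rewrite !mxE ?eqxx ?mulr1 ?addr0 //.
  by rewrite (negbTE kj) mulr0.
by rewrite -(dd _ i j) key dd.
Qed.

End Hessian.

(** * Strong convexity and Lipschitz gradients through the Hessian *)

Section Convexity.
Variables (R : realType) (m : nat).
Implicit Types (f : 'rV[R]_m -> R) (x u v : 'rV[R]_m).

(** The lower bound survives division by a small [s]. The second direction [w] serves two purposes:
    [w = v] gives the bound from strong convexity, and a change of sign of [w] the one from the
    Lipschitz condition. *)
Lemma hessian_ge f x v w K : differentiable (grad f) x ->
  (forall s, 0 < s -> s * K <= dot (grad f (x + s *: v) - grad f x) w) ->
  K <= dot (v *m hessian f x) w.
Proof.
move=> dg hK; apply/ler_addgt0Pr => e e0.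
have n1 : 0 < `|v| + 1 by rewrite ltr_wpDl.
have [d d0 hd] := grad_expansion w dg (divr_gt0 e0 n1).
pose s := d / (`|v| + 1) / 2.
have s0 : 0 < s by rewrite !divr_gt0.
have sv : `|s *: v| = s * `|v| by rewrite normrZ gtr0_norm.
have sd : `|s *: v| < d.
  rewrite sv /s mulrAC ltr_pdivrMr // mulrAC ltr_pdivrMr //.
  have : 0 <= d * `|v| by rewrite mulr_ge0 // ltW.
  by lra.
have := hd _ sd; rewrite -!dotBl -scalemxAl dotBl dotZl sv => h1.
have h2 := hK s s0.
have := ler_norml (dot (grad f (x + s *: v) - grad f x) w - s * dot (v *m hessian f x) w) (e / (`|v| + 1) * (s * `|v|)).
rewrite h1 => /esym/andP[_ h3]; rewrite -(ler_pM2l s0) mulrDr.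
have : e / (`|v| + 1) * (s * `|v|) <= s * e.
  rewrite mulrCA ler_pM2l // mulrAC ler_pdivrMr // ler_pM2l // lerDl //.
by lra.
Qed.

Lemma strongly_convex_hessian f mu x v : differentiable (grad f) x ->
  strongly_convex mu f -> mu * dot v v <= dot v (v *m hessian f x).
Proof.
move=> dg [_ sc]; rewrite [X in _ <= X]dotC; apply: hessian_ge => // s s0.
have := sc (x + s *: v) x; rewrite [x + _]addrC addrK sqr_norm2 dotZr dotZl dotZr => h.
by rewrite -(ler_pM2l s0); lra.
Qed.

Lemma lipschitz_hessian f l x v w : differentiable (grad f) x ->
  lipschitz_grad l f -> dot (v *m hessian f x) w <= l * (norm2 v * norm2 w).
Proof.
move=> dg lg; rewrite -lerN2 -dotNr; apply: hessian_ge => // s s0.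
rewrite dotNr mulrN lerN2; apply: le_trans (dot_le_norm2 _ _) _.
rewrite !mulrA ler_wpM2r ?norm2_ge0 // -mulrA mulrCA.
apply: le_trans (lg _ _) _; rewrite [x + _]addrC addrK le_eqVlt; apply/orP; left.
rewrite /norm2 dotZl dotZr mulrA -expr2 sqrtrM ?sqr_ge0 // sqrtr_sqr gtr0_norm //.
Qed.

(** The bilinear bound is tested against the image [w] itself; [l] carries no sign of its own, hence
    the absolute value. *)
Lemma lipschitz_hessian_image f l x v : differentiable (grad f) x ->
  lipschitz_grad l f -> norm2 (v *m hessian f x) <= `|l| * norm2 v.
Proof.
move=> dg lg; set w := v *m _.
have [->|w0] := eqVneq (norm2 w) 0; first by rewrite mulr_ge0 ?norm2_ge0.
have wp : 0 < norm2 w by rewrite lt_def w0 norm2_ge0.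
rewrite -(ler_pM2r wp) -expr2 sqr_norm2.
apply: le_trans (lipschitz_hessian v w dg lg) _; rewrite mulrA !ler_wpM2r ?norm2_ge0 //.
exact: ler_norm.
Qed.

(** Mean value theorem along a segment. It allows [mu] to be enlarged when the Hessian is found to
    be larger. *)
Lemma strongly_convex_of_hessian f mu : 0 < mu ->
  (forall x, differentiable (grad f) x) ->
  (forall x v, mu * dot v v <= dot v (v *m hessian f x)) -> strongly_convex mu f.
Proof.
move=> mu0 dg hH; split=> // x y; set d := x - y; rewrite sqr_norm2.
pose phi (t : R) := dot (grad f (y + t *: d)) d.
have hphi (t : R) : is_derive t 1 phi (dot (d *m hessian f (y + t *: d)) d).
  have h := is_derive_dot (is_derive_grad (dg _) (is_derive_line y d t)) (is_derive_cst d t 1).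
  by apply: is_derive_eq h _; rewrite dot0r addr0.
have cphi : {within `[0, 1], continuous phi}%classic.
  by apply: derivable_within_continuous => t _; exact: ex_derive.
have [t _] := MVT ltr01 (fun t _ => hphi t) cphi.
rewrite /phi scale0r scale1r addr0 subr0 mulr1 /d [y + _]addrC subrK -dotBl => ->.
by rewrite dotC.
Qed.

(** Since [2 B = mu |d|^2], strong convexity makes the derivative of [f (x + t d) - A t - B t^2]
    nonnegative for [t > 0]. *)
Lemma strongly_convex_bregman f mu x d : (forall w, differentiable f w) ->
  strongly_convex mu f ->
  mu / 2 * dot d d <= f (x + d) - f x - dot (grad f x) d.
Proof.
move=> df [_ sc].
pose A := dot (grad f x) d; pose B := mu / 2 * dot d d.
pose phi (t : R) := f (x + t *: d) - (A *: t + B *: (t * t)).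
have hphi (t : R) : is_derive t 1 phi (dot (grad f (x + t *: d)) d - (A *: 1 + B *: (t *: 1 + t *: 1))).
  apply: is_deriveB; first by apply: is_derive_along => //; exact: is_derive_line.
have cphi : {within `[0, 1], continuous phi}%classic.
  by apply: derivable_within_continuous => t _; exact: ex_derive.
have [t] := MVT ltr01 (fun t _ => hphi t) cphi.
rewrite in_itv /= => /andP[t0 _].
rewrite /phi scale0r scale1r addr0 subr0 !mulr1 /GRing.scale /= !mulr0 addr0 subr0 !mulr1.
have := sc (x + t *: d) x; rewrite [x + t *: d]addrC addrK sqr_norm2 !dotE => h.
have h2 : mu * dot d d * t <= dot (grad f (t *: d + x)) d - A.
  by rewrite -(ler_pM2l t0) /A; lra.
by rewrite -/A -/B; move: h2; rewrite /B; lra.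
Qed.

End Convexity.

(** * The IFP index *)

Section IfpIndex.
Variables (R : realType) (m : nat).
Implicit Types (f : 'rV[R]_m -> R) (M : 'M[R]_m) (v : 'rV[R]_m).
Local Open Scope classical_set_scope.

Lemma closed_quadratic (a b c : R) : closed [set t : R | a + b * t + c * t ^+ 2 <= 0].
Proof.
have -> : [set t : R | a + b * t + c * t ^+ 2 <= 0] =
    horner (a%:P + b *: 'X + c *: 'X^2) @^-1` [set y | y <= 0].
  by apply/seteqP; split => t /=; rewrite !hornerE.
by apply: preimage_closed (@closed_le R 0) => y _; exact: continuous_horner.
Qed.

Lemma norm2_le (B : R) (u v : 'rV[R]_m) : 0 <= B -> dot u u <= B ^+ 2 * dot v v ->
  norm2 u <= B * norm2 v.
Proof.
move=> B0 h; rewrite -ler_sqr ?nnegrE ?mulr_ge0 ?norm2_ge0 //.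
by rewrite exprMn !sqr_norm2.
Qed.

(** Cauchy-Schwarz on each column gives the Frobenius norm as a bound. It makes the [sup] in
    [opnorm2] a genuine supremum. *)
Lemma mulmx_bounded M : exists2 B : R, 0 <= B & forall v, norm2 (v *m M) <= B * norm2 v.
Proof.
pose K := \sum_j dot (col j M)^T (col j M)^T.
have K0 : 0 <= K by apply: sumr_ge0 => j _; exact: dot_ge0.
exists (Num.sqrt K) => [|v]; first exact: sqrtr_ge0.
apply: norm2_le; rewrite ?sqrtr_ge0 // sqr_sqrtr // mulrC mulr_sumr.
rewrite {1}/dot; apply: ler_sum => j _; rewrite -expr2.
suff -> : (v *m M) 0 j = dot v (col j M)^T by exact: cauchy_schwarz.
by rewrite mxE; apply: eq_bigr => k _; rewrite !mxE.
Qed.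

Lemma opnorm2_ge0 M : 0 <= opnorm2 M.
Proof.
have [B B0 HB] := mulmx_bounded M^T.
apply: ub_le_sup; last first.
  by exists 0; rewrite /= /norm2 ?mul0mx dot0l sqrtr0 ?ler01.
exists B => _ [v /= v1 <-]; apply: le_trans (HB v) _.
by rewrite -[leRHS]mulr1 ler_wpM2l.
Qed.

Lemma norm2Z (a : R) v : norm2 (a *: v) = `|a| * norm2 v.
Proof. by rewrite /norm2 dotZl dotZr mulrA -expr2 sqrtrM ?sqr_ge0 // sqrtr_sqr. Qed.

Lemma opnorm2_ub M v : norm2 (v *m M^T) <= opnorm2 M * norm2 v.
Proof.
have [B B0 HB] := mulmx_bounded M^T.
have [v0|v0] := eqVneq (norm2 v) 0.
  by have := HB v; rewrite v0 !mulr0.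
have vp : 0 < norm2 v by rewrite lt_def v0 norm2_ge0.
rewrite -ler_pdivrMr // mulrC -{1}[norm2 v]gtr0_norm // -normfV -norm2Z scalemxAl.
apply: ub_le_sup; last first.
  exists ((norm2 v)^-1 *: v) => //=.
  by rewrite norm2Z normfV gtr0_norm // mulVf // gt_eqF.
exists B => _ [w /= w1 <-]; apply: le_trans (HB w) _.
by rewrite -[leRHS]mulr1 ler_wpM2l.
Qed.

Lemma opnorm2_le M (B : R) : 0 <= B ->
  (forall v, norm2 (v *m M^T) <= B * norm2 v) -> opnorm2 M <= B.
Proof.
move=> B0 HB; apply: ge_sup.
  by exists (norm2 (0 *m M^T)), 0 => //=; rewrite /norm2 dot0l sqrtr0 ler01.
move=> _ [w /= w1 <-]; apply: le_trans (HB w) _.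
by rewrite -[leRHS]mulr1 ler_wpM2l.
Qed.

Variables (f : 'rV[R]_m -> R) (alpha beta gamma mu l : R).
Hypotheses (alpha0 : 0 < alpha) (gamma0 : 0 < gamma) (mu0 : 0 < mu).
Hypotheses (f_C2 : C2 f) (f_lip : lipschitz_grad l f).

Let dg x : differentiable (grad f) x. Proof. by case: f_C2 => _ /(_ x). Qed.
Let df x : differentiable f x. Proof. by case: f_C2 => /(_ x). Qed.

Let M (eta : R) x := eta *: ((alpha * beta) *: hessian f x - gamma%:M)
                               - (beta / gamma)%:M.

Lemma supply_tr eta x v : v *m (M eta x)^T = supply (hessian f) alpha beta gamma eta x v.
Proof.
have -> : (M eta x)^T = M eta x.
  rewrite /M; have := hessian_sym df (dg x); move: (hessian f x) => H Hs.
  by apply/matrixP => i j; rewrite !mxE -{1}Hs mxE eq_sym.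
rewrite /M.
rewrite mulmxBr -scalemxAr mulmxBr -scalemxAr !mul_mx_scalar scalerBr !scalerA.
by rewrite -addrA -opprD -scalerDl mulrA.
Qed.

(** Some [eta] comes within [e] of the infimum even if none attains it; unfolding the supremum and
    the operator norm yields a pointwise bound of the kind that [dissipation_ge] takes. *)
Lemma ifp_approx (e : R) : 0 < e ->
  exists2 eta, (mu * alpha * gamma)^-1 < eta & forall x v,
    dot (supply (hessian f) alpha beta gamma eta x v) (supply (hessian f) alpha beta gamma eta x v)
     <= 4 * (`|ifp_index alpha beta gamma mu f| + e) * (eta * mu * alpha - gamma^-1) * dot v v.
Proof.
move=> e0.
pose eta0 := (mu * alpha * gamma)^-1.
pose q eta x := opnorm2 (M eta x) ^+ 2 / (4 * (mu * eta * alpha - gamma^-1)).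
pose S eta := [set q eta x | x in [set: 'rV[R]_m]].
pose I := [set sup (S eta) | eta in [set eta : R | eta0 < eta]].
have den eta : eta0 < eta -> 0 < mu * eta * alpha - gamma^-1.
  move=> h; rewrite subr_gt0 mulrAC.
  have -> : gamma^-1 = mu * alpha * eta0 by rewrite /eta0; field; rewrite !gt_eqF.
  by rewrite ltr_pM2l // mulr_gt0.
(* The Lipschitz condition bounds the Hessian uniformly in [x]; on an unbounded set [sup] would not
   dominate the elements. *)
have Sub eta : eta0 < eta -> has_ubound (S eta).
  move=> he; pose a := eta * alpha * beta; pose b := eta * gamma + beta / gamma.
  pose B := Num.sqrt (2 * (a ^+ 2 * `|l| ^+ 2) + 2 * b ^+ 2).
  exists (B ^+ 2 / (4 * (mu * eta * alpha - gamma^-1))) => _ [x _ <-].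
  rewrite /q ler_wpM2r //; first by rewrite invr_ge0 mulr_ge0 // ltW ?den.
  rewrite ler_sqr ?nnegrE ?opnorm2_ge0 ?sqrtr_ge0 //.
  apply: opnorm2_le => [|v]; first exact: sqrtr_ge0.
  rewrite supply_tr; apply: norm2_le; first exact: sqrtr_ge0.
  rewrite sqr_sqrtr; last by rewrite !(sqr_ge0, addr_ge0, mulr_ge0).
  apply: le_trans (dot_sqrB _ _) _; rewrite !dotE -/a -/b.
  have := lipschitz_hessian_image v (dg x) f_lip.
  rewrite -ler_sqr ?nnegrE ?mulr_ge0 ?norm2_ge0 // exprMn !sqr_norm2 => h.
  by have := ler_wpM2l (sqr_ge0 a) h; lra.
have qub eta x : eta0 < eta -> q eta x <= sup (S eta).
  by move=> he; apply: ub_le_sup; [exact: Sub | exists x].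
have q0 eta x : eta0 < eta -> 0 <= q eta x.
  by move=> he; rewrite /q mulr_ge0 ?sqr_ge0 // invr_ge0 mulr_ge0 // ltW ?den.
have I0 : lbound I 0.
  by move=> _ [eta /= he <-]; apply: le_trans (qub _ 0 he); exact: q0.
have Ine : I !=set0 by exists (sup (S (eta0 + 1))), (eta0 + 1) => //=; rewrite ltrDl.
have -> : `|ifp_index alpha beta gamma mu f| = inf I.
  by rewrite /ifp_index normrN ger0_norm // lb_le_inf.
have [|_ [eta /= he <-] hs] := inf_adherent e0 (E := I); first by split=> //; exists 0.
exists eta => // x v.
have := le_lt_trans (qub eta x he) hs; rewrite /q ltr_pdivrMr ?mulr_gt0 ?den // => /ltW h.
rewrite -supply_tr -sqr_norm2; apply: le_trans (_ : (opnorm2 (M eta x) * norm2 v) ^+ 2 <= _).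
  by rewrite ler_sqr ?nnegrE ?mulr_ge0 ?opnorm2_ge0 ?norm2_ge0 // opnorm2_ub.
rewrite exprMn sqr_norm2 ler_wpM2r ?dot_ge0 //; apply: le_trans h _.
by rewrite le_eqVlt; apply/orP; left; apply/eqP; ring.
Qed.

(* [theta] is [eta^-1], which ranges over a compact interval once its two ends,
   the limits at infinity and at the left end of the range of [eta], are added. *)
Lemma ifp_attained : exists2 theta, 0 <= theta <= mu * alpha * gamma & forall x v,
  let w := (alpha * beta) *: (v *m hessian f x) - (gamma + theta * (beta / gamma)) *: v in
  dot w w <= 4 * `|ifp_index alpha beta gamma mu f|
              * (mu * alpha * theta - gamma^-1 * theta ^+ 2) * dot v v.
Proof.
set r := `| _ |; pose t0 := mu * alpha * gamma.
have t00 : 0 < t0 by rewrite !mulr_gt0.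
pose w theta x v := (alpha * beta) *: (v *m hessian f x) - (gamma + theta * (beta / gamma)) *: v.
pose P theta e := forall x v, dot (w theta x v) (w theta x v) <=
   4 * (r + e) * (mu * alpha * theta - gamma^-1 * theta ^+ 2) * dot v v.
have ex e : 0 < e -> exists2 theta, 0 <= theta <= t0 & P theta e.
  move=> e0; have [eta he H] := ifp_approx e0.
  have eta0 : 0 < eta by apply: lt_trans he; rewrite invr_gt0.
  exists eta^-1; first by rewrite invr_ge0 ltW //= -[t0]invrK lef_pV2 ?posrE ?invr_gt0 // ltW.
  move=> x v; have := H x v.
  have -> : supply (hessian f) alpha beta gamma eta x v = eta *: w eta^-1 x v.
    rewrite /supply /w scalerBr !scalerA; congr (_ *: _ - _ *: _); first by ring.
    by field; rewrite !gt_eqF.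
  rewrite dotZl dotZr => h; rewrite -(ler_pM2l (exprn_gt0 2 eta0)) expr2 -mulrA.
  apply: le_trans h _; rewrite le_eqVlt; apply/orP; left; apply/eqP; rewrite -/r.
  by field; rewrite !gt_eqF.
have {}ex (k : nat) : exists theta, 0 <= theta <= t0 /\ P theta (k.+1%:R^-1).
  by have [theta h1 h2] := ex k.+1%:R^-1 (ltac:(by rewrite invr_gt0)); exists theta.
have [th Hth] := choice ex.
have [p [pA pcl]] : `[0, t0] `&` cluster (th k @[k --> \oo]) !=set0.
  apply: (@segment_compact R 0 t0 (th k @[k --> \oo])).
  by exists 0%N => // k _; rewrite /= in_itv /=; case: (Hth k).
have pt : 0 <= p <= t0 by move: pA; rewrite /= in_itv.
have wp : 0 <= mu * alpha * p - gamma^-1 * p ^+ 2.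
  have /andP[p0 p1] := pt; rewrite expr2 mulrA -mulrBl mulr_ge0 // subr_ge0.
  by rewrite mulrC ler_pdivrMr.
have Pe e : 0 < e -> P p e.
  move=> e0 x v; rewrite -subr_le0.
  pose A := (alpha * beta) *: (v *m hessian f x) - gamma *: v.
  pose b := - 2 * (beta / gamma) * dot A v - 4 * (r + e) * (mu * alpha) * dot v v.
  pose c := (beta / gamma) ^+ 2 * dot v v + 4 * (r + e) * gamma^-1 * dot v v.
  (* For fixed [x] and [v] the inequality is quadratic in [theta], hence a closed condition, and
     [th k] satisfies it as soon as [1 / (k + 1) < e]. So it passes to the cluster point [p]. *)
  have polyE theta : dot (w theta x v) (w theta x v) -
     4 * (r + e) * (mu * alpha * theta - gamma^-1 * theta ^+ 2) * dot v v =
     dot A A + b * theta + c * theta ^+ 2.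
    have -> : w theta x v = A - (theta * (beta / gamma)) *: v by rewrite /w /A scalerDl opprD addrA.
    by rewrite /b /c; move: A {b c} => A; rewrite !dotE (dotC v A); ring.
  rewrite polyE.
  have := @closed_quadratic (dot A A) b c p.
  apply; move: pcl; rewrite clusterE; apply.
  have /= := near_infty_natSinv_lt (PosNum e0); apply: filterS => k /= ke.
  rewrite -polyE subr_le0; have [_ /(_ x v) h] := Hth k; apply: le_trans h _.
  rewrite ler_wpM2r ?dot_ge0 // ler_wpM2r //.
    have [/andP[p0 p1] _] := Hth k; rewrite expr2 mulrA -mulrBl mulr_ge0 // subr_ge0.
    by rewrite mulrC ler_pdivrMr.
  by rewrite ler_pM2l // lerD2l ltW.
exists p => // x v /=; apply/ler_addgt0Pr => e e0.
pose C := 4 * (mu * alpha * p - gamma^-1 * p ^+ 2) * dot v v.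
have C0 : 0 <= C by rewrite !mulr_ge0 ?dot_ge0.
have C1 : 0 < C + 1 by rewrite ltr_wpDl.
apply: le_trans (Pe (e / (C + 1)) _ x v) _; first by rewrite divr_gt0.
rewrite -/r.
have -> : 4 * (r + e / (C + 1)) * (mu * alpha * p - gamma^-1 * p ^+ 2) * dot v v =
  4 * r * (mu * alpha * p - gamma^-1 * p ^+ 2) * dot v v + e / (C + 1) * C.
  by rewrite /C; ring.
by rewrite lerD2l mulrAC ler_pdivrMr // ler_pM2l // lerDl.
Qed.

End IfpIndex.

(** * Functions with a nonpositive derivative off a countable set *)

Section Monotone.
Variable R : realType.
Local Open Scope classical_set_scope.
Implicit Types (g h : R -> R) (D : set R).

(** The solutions of [h t = v] in [[0, b]] form a nonempty compact set, and the greatest one is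
    taken. A later value at most [v] would produce a still later solution by the intermediate value
    theorem, because [v < h b]. *)
Lemma last_crossing h (b v : R) : 0 <= b -> {within `[0, b], continuous h} ->
  h 0 < v -> v < h b -> exists t, [/\ 0 < t, t < b, h t = v &
    forall s, t < s -> s <= b -> v < h s].
Proof.
move=> b0 ch v0 vb.
have [V cV VE] : exists2 V : set R, closed V & V `&` `[0, b] = h @^-1` [set v] `&` `[0, b].
  apply/closed_subspaceP.
  by move/continuous_closedP: ch; apply; exact: closed_eq.
have cK : compact (V `&` `[0, b]).
  by rewrite setIC; apply: compact_closedI => //; exact: segment_compact.
have root s : 0 <= s -> s <= b -> h s <= v -> exists2 c, s <= c & (V `&` `[0, b]) c.
  move=> s0 sb hs; have [| |c] := @IVT R h s b v sb.
  - apply: continuous_subspaceW ch => x /=; rewrite !in_itv /= => /andP[sx ->].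
    by rewrite (le_trans s0 sx).
  - by rewrite ge_min le_max hs (ltW vb) orbT.
  rewrite in_itv /= => /andP[sc cb] hc; exists c => //.
  have : (h @^-1` [set v] `&` `[0, b]) c by split=> //=; rewrite in_itv /= cb (le_trans s0 sc).
  by rewrite -VE.
have [c0 _ c0K] := root 0 (lexx _) b0 (ltW v0).
have [|t tK tmax] := @compact_EVT_max R R id _ (ex_intro _ c0 c0K) cK.
  by apply: continuous_subspaceT => x; exact: cvg_id.
have : (h @^-1` [set v] `&` `[0, b]) t by rewrite -VE; move: tK; rewrite inE.
move=> [/= ht]; rewrite in_itv /= => /andP[t0 tb].
have {}t0 : 0 < t.
  rewrite lt_def t0 andbT; apply: contraTneq v0 => tz; rewrite -ht tz ltxx //.
have {}tb : t < b.
  by rewrite lt_neqAle tb andbT; apply: contraTneq vb => tz; rewrite -ht tz ltxx.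
exists t; split=> // s ts sb; rewrite ltNge; apply/negP => hs.
have [c sc cK'] := root s (ltW (lt_trans t0 ts)) sb hs.
have := tmax c; rewrite inE => /(_ cK'); rewrite leNgt => /negP; apply.
exact: lt_le_trans ts sc.
Qed.

Lemma derive_right_ge0 h (t b dh : R) : t < b -> is_derive t 1 h dh ->
  (forall s, t < s -> s <= b -> h t <= h s) -> 0 <= dh.
Proof.
move=> tb [dh1 <-] hmin; rewrite leNgt; apply/negP => d0.
have /cvgr_lt/(_ 0 d0)/nbhs_ballP[d /= dp hd] : (fun s : R => s^-1 *: (h (s *: (1 : R) + t) - h t)) @ 0^' --> 'D_1 h t.
  exact: dh1.
pose s := Num.min (d / 2) (b - t).
have s0 : 0 < s by rewrite lt_min divr_gt0 //= subr_gt0.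
have := hd s; rewrite /= -ball_normE /= sub0r normrN gtr0_norm //.
have -> : s < d by rewrite gt_min ltr_pdivrMr // ltr_pMr // ltr1n.
move=> /(_ isT (lt0r_neq0 s0)); rewrite pmulr_rlt0 ?invr_gt0 // subr_lt0 ltNge => /negP; apply.
rewrite [s *: _]mulr1; apply: hmin; first by rewrite ltrDr.
by rewrite -lerBrDr /s ge_min lexx orbT.
Qed.

(* A larger final value would force every intermediate value to be taken for
   the last time at a point of [D], and an interval is not countable. *)
Lemma nonincreasing_countable g D : {within `[0, +oo[, continuous g} -> countable D ->
  (forall t, 0 < t -> ~ D t -> exists2 dg, is_derive t 1 g dg & dg <= 0) ->
  forall t, 0 <= t -> g t <= g 0.
Proof.
move=> cg cD dg b b0; rewrite leNgt; apply/negP => gb.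
have {}b0 : 0 < b by rewrite lt_def b0 andbT; apply: contraTneq gb => ->; rewrite ltxx.
(* Half the mean slope of [g]: subtracting [e t] makes the derivative strictly negative off [D] and
   still keeps [h b] above [h 0]. *)
pose e := (g b - g 0) / (2 * b).
have e0 : 0 < e by rewrite divr_gt0 ?mulr_gt0 // subr_gt0.
pose h t := g t - e * t.
have h0b : h 0 < h b.
  rewrite /h mulr0 subr0 /e.
  have -> : (g b - g 0) / (2 * b) * b = (g b - g 0) / 2 by field; rewrite gt_eqF.
  by lra.
have ch : {within `[0, b], continuous h}.
  move=> x; apply: continuousB.
    apply: (continuous_subspaceW _ cg) => y /=; rewrite !in_itv /= andbT.
    by case/andP.
  by apply: continuous_subspaceT => y; exact: mulrl_continuous.
have sub : `]h 0, h b[ `<=` h @` D.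
  move=> v /=; rewrite in_itv /= => /andP[v0 vb].
  have [t [t0 tb ht hs]] := last_crossing (ltW b0) ch v0 vb.
  exists t => //; apply: contrapT => /(dg t t0)[d hd d0].
  have hh : is_derive t 1 h (d - e *: 1).
    exact: is_deriveB.
  have : 0 <= d - e *: 1.
    by apply: (derive_right_ge0 tb hh) => s ts sb; rewrite ht; apply/ltW; exact: hs.
  by rewrite [e *: 1]mulr1; lra.
have cI : countable `]h 0, h b[.
  apply: sub_countable cD; apply: card_le_trans (card_image_le h D).
  exact: subset_card_le.
have := countable_lebesgue_measure0 cI; rewrite lebesgue_measure_itv /= lte_fin h0b.
by move/eqP; rewrite -EFinB eqe subr_eq0 gt_eqF.
Qed.

End Monotone.

(** * Storage functions of the agents *)

Section Agent.
Variables (R : realType) (m : nat).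
Local Open Scope classical_set_scope.

Lemma cvg_coord (T : Type) (F : set_system T) (FF : Filter F) (X : T -> 'rV[R]_m) (x : 'rV[R]_m) k :
  X @ F --> x -> X t 0 k @[t --> F] --> x 0 k.
Proof.
move=> hX; apply: (cvg_comp X (fun y : 'rV[R]_m => y 0 k)) hX _.
exact: differentiable_continuous (differentiable_coord x 0 k).
Qed.

Lemma cvg_dot (T : Type) (F : set_system T) (FF : Filter F) (X Y : T -> 'rV[R]_m) (x y : 'rV[R]_m) :
  X @ F --> x -> Y @ F --> y -> dot (X t) (Y t) @[t --> F] --> dot x y.
Proof.
move=> hX hY; apply: cvg_big => [|k _]; first exact: add_continuous.
by apply: cvgM; exact: cvg_coord.
Qed.

Variables (f : 'rV[R]_m -> R) (alpha beta gamma mu l : R) (v0 : 'rV[R]_m).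
Hypotheses (alpha0 : 0 < alpha) (gamma0 : 0 < gamma) (v0_neq0 : v0 != 0).
Hypotheses (f_C2 : C2 f) (f_lip : lipschitz_grad l f) (f_sc : strongly_convex mu f).

Let dg x : differentiable (grad f) x. Proof. by case: f_C2 => _ /(_ x). Qed.
Let df x : differentiable f x. Proof. by case: f_C2 => /(_ x). Qed.
Let mu0 : 0 < mu. Proof. by case: f_sc. Qed.
Let r := `|ifp_index alpha beta gamma mu f|.
Let nv0 : 0 < dot v0 v0.
Proof. by rewrite lt_def dot_ge0 andbT; apply: contra_neq v0_neq0 => /dot_eq0. Qed.

(** The limit value [theta] of [1 / eta] decides: 0 gives the first alternative, and an interior
    [theta] an admissible [eta = 1 / theta]. At the right end the supply vanishes at
    [eta = 1 / theta], and enlarging [mu] makes this [eta] admissible. *)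
Lemma ifp_cases :
  (0 < beta /\ forall x (v : 'rV[R]_m), (alpha * beta) *: (v *m hessian f x) = gamma *: v) \/
  exists mu' eta omega c : R, strongly_convex mu' f /\
    [/\ gamma^-1 < eta * mu' * alpha, omega < beta, 0 < c, (r = 0 -> omega = 0) &
        forall x y u, c * dot (y - omega *: u) (y - omega *: u)
                      <= dissipation (hessian f) alpha beta gamma r eta x y u].
Proof.
have Hsym x : (hessian f x)^T = hessian f x by exact: hessian_sym.
have Hl x v : dot v (v *m hessian f x) <= l * dot v v.
  by rewrite dotC; have := lipschitz_hessian v v (dg x) f_lip; rewrite -expr2 sqr_norm2.
have Hmu x v := @strongly_convex_hessian R m f mu x v (dg x) f_sc.
have [th /andP[th0 th1] /= H] := ifp_attained beta alpha0 gamma0 mu0 f_C2 f_lip.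
rewrite -/r in H; have r0 : 0 <= r by exact: normr_ge0.
pose A := dot v0 (v0 *m hessian f 0).
have A1 : mu * dot v0 v0 <= A by exact: Hmu.
have A0 : 0 < A by apply: lt_le_trans A1; rewrite mulr_gt0.
have [z|thn] := eqVneq th 0.
  left; have E x (v : 'rV[R]_m) : (alpha * beta) *: (v *m hessian f x) = gamma *: v.
    apply/eqP; rewrite -subr_eq0; apply/eqP/dot_eq0/eqP; rewrite eq_le dot_ge0 andbT.
    by have := H x v; rewrite z mul0r addr0 expr0n !mulr0 subr0 mulr0 mul0r.
  split=> //; have := congr1 (dot v0) (E 0 v0); rewrite !dotZr -/A => e.
  have : 0 < alpha * beta * A by rewrite e mulr_gt0.
  by rewrite pmulr_lgt0 // pmulr_rgt0.
right; have thp : 0 < th by rewrite lt_def thn.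
have [e|thm] := eqVneq th (mu * alpha * gamma).
  have E x (v : 'rV[R]_m) : (alpha * beta) *: (v *m hessian f x) = (gamma + mu * alpha * beta) *: v.
    apply/eqP; rewrite -subr_eq0; apply/eqP/dot_eq0/eqP; rewrite eq_le dot_ge0 andbT.
    have := H x v; rewrite e.
    have -> : gamma + mu * alpha * gamma * (beta / gamma) = gamma + mu * alpha * beta.
      by field; rewrite gt_eqF.
    have -> : mu * alpha * (mu * alpha * gamma) - gamma^-1 * (mu * alpha * gamma) ^+ 2 = 0.
      by field; rewrite gt_eqF.
    by rewrite mulr0 mul0r.
  have b0 : 0 < beta.
    have := congr1 (dot v0) (E 0 v0); rewrite !dotZr -/A => eA.
    rewrite ltNge; apply/negP => b0.
    have : alpha * beta * A <= alpha * beta * (mu * dot v0 v0).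
      by apply: ler_wnM2l => //; rewrite pmulr_rle0.
    have : 0 < gamma * dot v0 v0 by rewrite mulr_gt0.
    by rewrite eA; lra.
  have ab : 0 < alpha * beta by rewrite mulr_gt0.
  pose mu' := mu + gamma / (alpha * beta).
  have mup : 0 < mu' by rewrite addr_gt0 // divr_gt0.
  have Hmu' x v : mu' * dot v v <= dot v (v *m hessian f x).
    rewrite -(ler_pM2l ab) -[leRHS]dotZr E dotZr le_eqVlt; apply/orP; left; apply/eqP.
    by rewrite /mu'; field; rewrite !gt_eqF.
  have th2 : gamma^-1 < th^-1 * mu' * alpha.
    rewrite -(ltr_pM2l thp) e mulfK ?gt_eqF // -e.
    have -> : th * (th^-1 * mu' * alpha) = mu' * alpha by rewrite !mulrA mulfV // mul1r.
    by rewrite ltr_pM2r // /mu' ltrDl divr_gt0.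
  have [|eta [om [c h]]] := dissipation_ge (beta := beta) 0 alpha0 gamma0 mup r0 v0_neq0 Hsym Hmu' Hl th2.
    move=> x v; have -> : supply (hessian f) alpha beta gamma th^-1 x v = 0.
      rewrite /supply -!mulrA -scalerA E scalerA -scalerBl.
      have -> : th^-1 * (gamma + mu * alpha * beta) - (th^-1 * gamma + beta / gamma) = 0.
        by rewrite e; field; rewrite !gt_eqF.
      by rewrite scale0r.
    by rewrite dot0l !mulr_ge0 ?dot_ge0 // subr_ge0 ltW.
  exists mu', eta, om, c; split=> //; exact: strongly_convex_of_hessian.
have th2 : gamma^-1 < th^-1 * mu * alpha.
  have : th < mu * alpha * gamma by rewrite lt_neqAle thm.
  move=> h; rewrite -(ltr_pM2l thp).
  have -> : th * (th^-1 * mu * alpha) = mu * alpha by rewrite !mulrA mulfV // mul1r.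
  by rewrite ltr_pdivrMr.
have [|eta [om [c h]]] := dissipation_ge (beta := beta) 0 alpha0 gamma0 mu0 r0 v0_neq0 Hsym Hmu Hl th2.
  move=> x v; have := H x v; set w := _ - _ => hw.
  have -> : supply (hessian f) alpha beta gamma th^-1 x v = th^-1 *: w.
    rewrite /supply /w scalerBr !scalerA; congr (_ *: _ - _ *: _); first by ring.
    by field; rewrite !gt_eqF.
  rewrite dotZl dotZr mulrA; apply: le_trans (ler_wpM2l _ hw) _.
    by rewrite -expr2 sqr_ge0.
  by rewrite le_eqVlt; apply/orP; left; apply/eqP; field; rewrite !gt_eqF.
by exists mu, eta, om, c.
Qed.

(** The order of the quantifiers matters: [omega], [c] and [C] precede [d], so the error
    [C d^2 |x - z|^2] is of second order against the gain [d (x - z).u]. Continuity is stated along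
    filters so as to apply directly to trajectories continuous on a half-line. *)
Lemma agent_storage (z : 'rV[R]_m) :
  exists omega c C : R, [/\ (r = 0 -> omega = 0), 0 < c, 0 <= C &
  forall d, 0 < d -> exists (W : 'rV[R]_m -> 'rV[R]_m -> R) (k1 k2 : R), 0 < k1 /\
  [/\ (forall x lam, k1 * (dot (x - z) (x - z)
           + dot (alpha *: grad f x + lam) (alpha *: grad f x + lam)) <= W x lam),
      (forall x lam, W x lam <= k2 * (dot (x - z) (x - z)
           + dot (alpha *: grad f x + lam) (alpha *: grad f x + lam))),
      (forall (T : Type) (F : set_system T) (FF : Filter F) (X L : T -> 'rV[R]_m) (x lam : 'rV[R]_m),
         X @ F --> x -> L @ F --> lam -> W (X t) (L t) @[t --> F] --> W x lam) &
      forall (X L : R -> 'rV[R]_m) (t : R) u,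
        is_derive t 1 X (- alpha *: grad f (X t) - L t + beta *: u) ->
        is_derive t 1 L (- gamma *: u) ->
        let y := alpha *: grad f (X t) + L t in
        exists2 dW, is_derive t 1 (fun s => W (X s) (L s)) dW &
          dW <= (1 + d) * dot (X t - z) u + r * dot u u
            - c * dot (y - omega *: u) (y - omega *: u)
            + C * d ^+ 2 * dot (X t - z) (X t - z)]].
Proof.
have r0 : 0 <= r by exact: normr_ge0.
have cf (T : Type) (F : set_system T) (FF : Filter F) (X : T -> 'rV[R]_m) (x : 'rV[R]_m) :
    X @ F --> x -> f (X t) @[t --> F] --> f x.
  by move=> hX; apply: (cvg_comp X f) hX _; exact: differentiable_continuous (df x).
have cg (T : Type) (F : set_system T) (FF : Filter F) (X : T -> 'rV[R]_m) (x : 'rV[R]_m) :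
    X @ F --> x -> grad f (X t) @[t --> F] --> grad f x.
  by move=> hX; apply: (cvg_comp X (grad f)) hX _; exact: differentiable_continuous (dg x).
have dy (X L : R -> 'rV[R]_m) (t : R) dX dL :
    is_derive t 1 X dX -> is_derive t 1 L dL ->
    is_derive t 1 (fun s => alpha *: grad f (X s) + L s) (alpha *: (dX *m hessian f (X t)) + dL).
  by move=> hX hL; exact: (is_deriveD (is_deriveZ alpha (is_derive_grad (dg _) hX)) hL).
have dxz (X : R -> 'rV[R]_m) (t : R) dX :
    is_derive t 1 X dX -> is_derive t 1 (fun s => X s - z) dX.
  by move=> hX; have := is_deriveB hX (is_derive_cst z t 1); rewrite subr0.
have [[b0 E]|[mu' [eta [om [c [sc [he hom c0 hr hF]]]]]]] := ifp_cases.
  exists 0, 1, 1; split=> // d d0.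
  have b1 : 0 < 2 * beta by rewrite mulr_gt0.
  have d1 : 0 < 1 + d by rewrite addr_gt0.
  (* Young weight with [k a = d^2]; [K] then absorbs [k / a |y|^2] and leaves [- |y|^2]. *)
  pose a := 2 * beta * d ^+ 2 / (1 + d).
  have a0 : 0 < a by rewrite divr_gt0 // mulr_gt0 // exprn_gt0.
  pose k := (1 + d) / (2 * beta); have k0 : 0 < k by rewrite divr_gt0.
  pose K := (k * a^-1 + 1) * (beta / gamma).
  have K0 : 0 < K by rewrite mulr_gt0 ?divr_gt0 // addr_gt0 // divr_gt0.
  exists (fun x lam => k * dot (x - z) (x - z)
     + K / 2 * dot (alpha *: grad f x + lam) (alpha *: grad f x + lam)).
  exists (Num.min k (K / 2)), (k + K / 2); split; first by rewrite lt_min k0 divr_gt0.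
  split.
  - move=> x lam; rewrite mulrDr lerD // ler_wpM2r ?dot_ge0 //.
      by rewrite ge_min lexx.
    by rewrite ge_min lexx orbT.
  - move=> x lam; set A := dot (x - z) _; set B := dot (_ + _) _.
    have : 0 <= k * B by rewrite mulr_ge0 ?dot_ge0 // ltW.
    have : 0 <= K / 2 * A by rewrite mulr_ge0 ?dot_ge0 // ltW // divr_gt0.
    by lra.
  - move=> T F FF X L x lam hX hL.
    have hX' : X t - z @[t --> F] --> x - z by apply: cvgB => //; exact: cvg_cst.
    have hy : alpha *: grad f (X t) + L t @[t --> F] --> alpha *: grad f x + lam.
      by apply: cvgD => //; apply: cvgZl_tmp; exact: cg.
    by apply: cvgD; (apply: cvgM; [exact: cvg_cst | exact: cvg_dot]).
  move=> X L t u hX hL y.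
  pose xt := X t - z.
  have hx := dxz _ _ _ hX; have hy := dy _ _ _ _ _ hX hL.
  have hW := is_deriveD (is_deriveZ k (is_derive_dot hx hx)) (is_deriveZ (K / 2) (is_derive_dot hy hy)).
  eexists; first exact: hW.
  have -> : - alpha *: grad f (X t) - L t + beta *: u = beta *: u - y.
    by rewrite /y opprD scaleNr addrC.
  (* As [alpha beta hess f = gamma I], the input cancels and [y' = - (gamma / beta) y]. *)
  have -> : alpha *: ((beta *: u - y) *m hessian f (X t)) + - gamma *: u = - (gamma / beta) *: y.
    have yH : y *m hessian f (X t) = (gamma / (alpha * beta)) *: y.
      by rewrite mulrC -scalerA -(E (X t)) scalerA mulVf ?scale1r // gt_eqF // mulr_gt0.
    rewrite mulmxBl -scalemxAl scalerBr scalerA E yH scalerA addrAC scaleNr subrr sub0r -scaleNr.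
    by congr (_ *: _); field; rewrite !gt_eqF.
  rewrite -/y scale0r subr0 mul1r -/xt; move: (y) (xt) => {}y {}xt.
  rewrite !dotE (dotC u xt) (dotC y xt) /GRing.scale /=.
  set A := dot xt u; set B := dot xt y; set Y := dot y y; set Q := dot xt xt; set U := dot u u.
  have yg : - 2 * B <= a * Q + a^-1 * Y.
    by have := young (- xt) y a0; rewrite !dotE opprK; rewrite -/B -/Q -/Y; lra.
  have U0 : 0 <= r * U by rewrite mulr_ge0 ?dot_ge0.
  have := ler_wpM2l (ltW k0) yg.
  have -> : k * (a * Q + a^-1 * Y) = d ^+ 2 * Q + k / a * Y.
    by rewrite /k /a; field; rewrite !gt_eqF // exprn_gt0.
  have -> : k * (beta * A - B + (beta * A - B)) + K / 2 * (- (gamma / beta) * Y + - (gamma / beta) * Y)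
     = (1 + d) * A + k * (- 2 * B) - (k / a + 1) * Y.
    by rewrite /K /k; field; rewrite !gt_eqF.
  by lra.
pose kap := beta - om; have kap0 : 0 < kap by rewrite subr_gt0.
have mup : 0 < mu' by case: sc.
have gi : 0 < gamma^-1 by rewrite invr_gt0.
have eta0 : 0 < eta.
  have : 0 < eta * mu' * alpha by lra.
  by rewrite !pmulr_lgt0.
pose C := (2 * kap ^+ 2 * c)^-1.
exists om, (c / 2), C; split=> //; rewrite ?divr_gt0 //.
  by rewrite invr_ge0 !mulr_ge0 ?sqr_ge0 // ltW.
move=> d d0; pose k := d / (2 * kap).
have k0 : 0 < k by rewrite divr_gt0 // mulr_gt0.
pose V (x lam : 'rV[R]_m) := eta / 2 * dot (alpha *: grad f x + lam) (alpha *: grad f x + lam)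
   - gamma^-1 * (dot (x - z) lam + alpha * (f x - f z)).
exists (fun x lam => V x lam + k * dot (x - z) (x - z)).
pose ge := (gamma * eta)^-1.
(* [V] is bounded below by [eta / 2 |y|^2 - (x - z).y / gamma + alpha mu' / (2 gamma) |x - z|^2],
   which is positive definite because [1 / gamma < eta mu' alpha]. The Young weights showing it lie
   between [ge] and [alpha mu']; [a] is their midpoint. *)
pose a := (alpha * mu' + ge) / 2.
have ge0 : 0 < ge by rewrite invr_gt0 mulr_gt0.
have gea : ge < alpha * mu'.
  rewrite -(ltr_pM2l eta0) /ge invfM mulrCA mulfV ?gt_eqF // mulr1.
  by rewrite (mulrC alpha) mulrA.
have a1 : a < alpha * mu' by rewrite /a; lra.
have a2 : ge < a by rewrite /a; lra.
have a0 : 0 < a by lra.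
pose p := gamma^-1 / 2 * (alpha * mu' - a).
pose q := eta / 2 - gamma^-1 / 2 * a^-1.
have p0 : 0 < p by rewrite mulr_gt0 ?divr_gt0 // subr_gt0.
have q0 : 0 < q.
  have : gamma^-1 * a^-1 < eta.
    by rewrite ltr_pdivrMl // -[gamma * eta]invrK ltf_pV2 ?posrE.
  by rewrite /q; lra.
exists (Num.min p q), (eta / 2 + gamma^-1 / 2 + alpha / gamma * `|l| + k).
split; first by rewrite lt_min p0.
(* Eliminating [lam] in favour of [y] leaves a Bregman distance of [f], bounded below by strong
   convexity and above thanks to the Lipschitz gradient. *)
have VE x lam : V x lam = eta / 2 * dot (alpha *: grad f x + lam) (alpha *: grad f x + lam)
   - gamma^-1 * dot (x - z) (alpha *: grad f x + lam)
   + alpha / gamma * (dot (grad f x) (x - z) - (f x - f z)).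
  by rewrite /V (dotDr (x - z)) dotZr (dotC (x - z) (grad f x)); ring.
split.
- move=> x lam; rewrite VE; set y := alpha *: _ + _.
  have := @strongly_convex_bregman R m f mu' x (z - x) df sc.
  rewrite (addrC x) subrK -[z - x]opprB !(dotNl, dotNr) opprK.
  set Q := dot (x - z) (x - z); set B := dot (grad f x) _; set Y := dot y y => h.
  have Q0 : 0 <= Q by exact: dot_ge0.
  have Y0 : 0 <= Y by exact: dot_ge0.
  have hy := young (x - z) y a0; rewrite -/Q -/Y in hy.
  have : Num.min p q * (Q + Y) <= p * Q + q * Y.
    by rewrite mulrDr lerD // ler_wpM2r // ge_min lexx ?orbT.
  have : 0 <= k * Q by rewrite mulr_ge0 // ltW.
  have ag : 0 < alpha / gamma by rewrite divr_gt0.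
  have := ler_wpM2l (ltW ag) h.
  have := ler_wpM2l (ltW gi) hy.
  by rewrite /p /q; lra.
- move=> x lam; rewrite VE; set y := alpha *: _ + _.
  have := @strongly_convex_bregman R m f mu' z (x - z) df sc.
  rewrite (addrC z) subrK.
  set Q := dot (x - z) (x - z); set Y := dot y y => h.
  have Q0 : 0 <= Q by exact: dot_ge0.
  have Y0 : 0 <= Y by exact: dot_ge0.
  have hl : dot (grad f x) (x - z) - dot (grad f z) (x - z) <= `|l| * Q.
    rewrite -dotBl; apply: le_trans (dot_le_norm2 _ _) _.
    rewrite /Q -sqr_norm2 expr2 mulrA ler_wpM2r ?norm2_ge0 //.
    by apply: le_trans (f_lip x z) _; rewrite ler_wpM2r ?norm2_ge0 // ler_norm.
  have hB : dot (grad f x) (x - z) - (f x - f z) <= `|l| * Q.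
    have : 0 <= mu' / 2 * Q by rewrite mulr_ge0 // ltW // divr_gt0.
    by lra.
  have hy := young (- (x - z)) y ltr01; rewrite dotNl dotNl dotNr opprK invr1 !mul1r -/Q -/Y in hy.
  have ag : 0 < alpha / gamma by rewrite divr_gt0.
  have := ler_wpM2l (ltW ag) hB.
  have := ler_wpM2l (ltW gi) hy.
  have : 0 <= eta / 2 * Q by rewrite mulr_ge0 // ltW // divr_gt0.
  have : 0 <= alpha / gamma * `|l| * Y by rewrite !mulr_ge0 // ltW.
  have : 0 <= k * Y by rewrite mulr_ge0 // ltW.
  by lra.
- move=> T F FF X L x lam hX hL.
  have hX' : X t - z @[t --> F] --> x - z by apply: cvgB => //; exact: cvg_cst.
  have hy : alpha *: grad f (X t) + L t @[t --> F] --> alpha *: grad f x + lam.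
    by apply: cvgD => //; apply: cvgZl_tmp; exact: cg.
  apply: cvgD; last by apply: cvgM; [exact: cvg_cst | exact: cvg_dot].
  apply: cvgB; first by apply: cvgM; [exact: cvg_cst | exact: cvg_dot].
  apply: cvgM; first exact: cvg_cst.
  apply: cvgD; first exact: cvg_dot.
  by apply: cvgM; [exact: cvg_cst | apply: cvgB; [exact: cf | exact: cvg_cst]].
move=> X L t u hX hL y.
pose xt := X t - z.
have hx := dxz _ _ _ hX; have hy := dy _ _ _ _ _ hX hL.
have hf := is_derive_along (df _) hX.
have hfz := is_deriveB hf (is_derive_cst (f z) t 1).
have hW := is_deriveD (is_deriveB (is_deriveZ (eta / 2) (is_derive_dot hy hy))
    (is_deriveZ gamma^-1 (is_deriveD (is_derive_dot hx hL) (is_deriveZ alpha hfz))))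
  (is_deriveZ k (is_derive_dot hx hx)).
eexists; first exact: hW.
have -> : - alpha *: grad f (X t) - L t + beta *: u = beta *: u - y.
  by rewrite /y opprD scaleNr addrC.
have gE : dot (grad f (X t)) (beta *: u - y) = alpha^-1 * (dot y (beta *: u - y) - dot (L t) (beta *: u - y)).
  by rewrite /y dotDl dotZl addrK mulKf // gt_eqF.
have := hF (X t) y u; rewrite /dissipation /supply gE subr0.
rewrite -/y -/xt (dotC xt (- gamma *: u)) mulmxBl -scalemxAl.
move: (y) (xt) (L t) (u *m hessian f (X t)) (y *m hessian f (X t)) => w p' lam uH yH.
(* Young weight with [k b = C d^2] and [k / b = c / 2]: half of the dissipation pays for the cross
   term of [x - z] with [y - omega u]. *)
pose b := d / (kap * c); have b0 : 0 < b by rewrite divr_gt0 // mulr_gt0.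
have e1 : k * b = C * d ^+ 2 by rewrite /k /b /C; field; rewrite !gt_eqF.
have e2 : k * b^-1 = c / 2 by rewrite /k /b; field; rewrite !gt_eqF.
have e3 : k * beta * 2 = d + k * om * 2.
  by rewrite /k /kap; field; rewrite gt_eqF.
have hz : k * (2 * dot (- p') (w - om *: u)) <= C * d ^+ 2 * dot (- p') (- p')
    + c / 2 * dot (w - om *: u) (w - om *: u).
  by rewrite -e1 -e2; have := ler_wpM2l (ltW k0) (young (- p') (w - om *: u) b0); lra.
rewrite !dotE opprK in hz; rewrite !dotE /GRing.scale /= mulVKf ?gt_eqF //.
have := congr1 (fun x => x * dot p' u) e3; move: hz.
rewrite (dotC u w) (dotC uH w) (dotC yH w) (dotC u lam) (dotC w lam) (dotC u p') (dotC w p').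
set d1 := dot p' u; set d2 := dot p' w; set d3 := dot w w; set d4 := dot w u; set d5 := dot u u.
have : gamma^-1 * gamma * d1 = d1 by rewrite mulVf ?gt_eqF // mul1r.
lra.
Qed.
End Agent.

(** * The network *)

Section Bounds.
Variables (R : realType) (N : nat).

Lemma fin_lower_bound (F : 'I_N -> R) : (forall i, 0 < F i) ->
  exists2 c, 0 < c & forall i, c <= F i.
Proof.
move=> F0; exists (1 + \sum_i (F i)^-1)^-1 => [|i].
  by rewrite invr_gt0 ltr_wpDr // sumr_ge0 // => i _; rewrite invr_ge0 ltW.
rewrite -[F i]invrK lef_pV2 ?posrE ?invr_gt0 //; last first.
  by rewrite ltr_wpDr // sumr_ge0 // => j _; rewrite invr_ge0 ltW.
rewrite (bigD1 i) //= addrCA lerDl addr_ge0 // sumr_ge0 // => j _.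
by rewrite invr_ge0 ltW.
Qed.

Lemma fin_upper_bound (F : 'I_N -> R) : exists2 c, 0 < c & forall i, F i <= c.
Proof.
have s0 : 0 <= \sum_i `|F i| by apply: sumr_ge0.
exists (1 + \sum_i `|F i|) => [|i]; first by rewrite ltr_wpDr.
apply: le_trans (ler_norm _) _; rewrite (bigD1 i) //= addrCA lerDl addr_ge0 //.
exact: sumr_ge0.
Qed.

End Bounds.

(** * Coupling over a weight-balanced digraph *)

Section Network.
Variables (R : realType) (N m : nat) (e : rel 'I_N) (A : 'M[R]_N).
Hypotheses (A_adj : adjacency e A) (A_bal : weight_balanced A).
Implicit Types (x y : 'I_N -> 'rV[R]_m).

Lemma adjacency_ge0 i j : 0 <= A i j.
Proof.
have [h1 h2] := A_adj i j.
by case: (boolP (e j i)) => [/h1/ltW|/h2 ->].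
Qed.

(** Summed over [i], on a weight-balanced digraph, this is twice the quadratic form of the
    Laplacian. *)
Definition disagreement x i : R := \sum_j A i j * dot (x j - x i) (x j - x i).

Lemma disagreement_ge0 x i : 0 <= disagreement x i.
Proof. by apply: sumr_ge0 => j _; rewrite mulr_ge0 ?adjacency_ge0 ?dot_ge0. Qed.

Lemma balanced_sum (V : lmodType R) (v : 'I_N -> V) :
  \sum_i \sum_j A i j *: v j = \sum_i \sum_j A i j *: v i.
Proof.
rewrite exchange_big; apply: eq_bigr => j _ /=.
by rewrite -!scaler_suml; congr (_ *: _); rewrite -[LHS]/(out_degree A j) -A_bal.
Qed.

Lemma sum_coupling s x : \sum_i coupling A s x i = 0.
Proof.
rewrite /coupling -scaler_sumr.
under eq_bigr do [under eq_bigr do rewrite scalerBr; rewrite sumrB].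
by rewrite sumrB balanced_sum subrr scaler0.
Qed.

(** [2 a.(b - a) = |b|^2 - |a|^2 - |b - a|^2] for [a = x i - z] and [b = x j - z]; the first two
    squares cancel by balance. *)
Lemma sum_dot_coupling s x (z : 'rV[R]_m) :
  \sum_i dot (x i - z) (coupling A s x i) = - (s / 2) * \sum_i disagreement x i.
Proof.
have hb : \sum_i \sum_j A i j * dot (x j - z) (x j - z) =
    \sum_i \sum_j A i j * dot (x i - z) (x i - z).
  exact: (@balanced_sum R^o (fun i => dot (x i - z) (x i - z))).
rewrite /coupling.
under eq_bigr do rewrite dotZr dot_sumr.
rewrite -mulr_sumr mulNr -mulrA -mulrN; congr (_ * _).
have key i j : A i j * dot (x i - z) (x j - x i) =
    2^-1 * (A i j * dot (x j - z) (x j - z)) - 2^-1 * (A i j * dot (x i - z) (x i - z))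
    - 2^-1 * (A i j * dot (x j - x i) (x j - x i)).
  have -> : x j - x i = (x j - z) - (x i - z) by rewrite opprB addrA subrK.
  by move: (x i - z) (x j - z) => p q; rewrite !dotE (dotC q p); lra.
under eq_bigr do [under eq_bigr do rewrite dotZr key; rewrite !sumrB -!mulr_sumr].
by rewrite !sumrB -!mulr_sumr hb subrr sub0r.
Qed.

(** Cauchy-Schwarz with the weights [A i j], whose total is the in-degree, obtained from Young's
    inequality in each term of the double sum. *)
Lemma coupling_le s x i :
  dot (coupling A s x i) (coupling A s x i) <= s ^+ 2 * (in_degree A i * disagreement x i).
Proof.
rewrite /coupling dotZl dotZr mulrA -expr2 ler_wpM2l ?sqr_ge0 //.
pose v j := x j - x i.
have -> : in_degree A i * disagreement x i =
   \sum_j \sum_k A i j * A i k * ((dot (v j) (v j) + dot (v k) (v k)) / 2).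
  transitivity (2^-1 * (in_degree A i * disagreement x i + disagreement x i * in_degree A i)).
    by field.
  have e1 : in_degree A i * disagreement x i =
      \sum_j \sum_k A i j * (A i k * dot (v k) (v k)).
    by rewrite mulr_suml; apply: eq_bigr => j _; rewrite mulr_sumr.
  have e2 : disagreement x i * in_degree A i =
      \sum_j \sum_k A i j * dot (v j) (v j) * A i k.
    by rewrite mulr_suml; apply: eq_bigr => j _; rewrite mulr_sumr.
  rewrite e1 e2 -big_split mulr_sumr; apply: eq_bigr => j _.
  by rewrite -big_split mulr_sumr; apply: eq_bigr => k _ /=; field.
rewrite dot_suml; apply: ler_sum => j _; rewrite dot_sumr; apply: ler_sum => k _.
rewrite dotZl dotZr mulrA ler_wpM2l ?mulr_ge0 ?adjacency_ge0 //.
have := young (v j) (v k) ltr01; rewrite invr1 !mul1r /v; lra.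
Qed.

Hypothesis e_conn : strongly_connected e.

(** An edge from [i] to [j] has weight [A j i > 0], so its difference appears in [disagreement x j].
    Bounds combine along a path, and finitely many pairs share one constant. *)
Lemma disagreement_pair : exists2 C, 0 < C & forall x i j,
  dot (x i - x j) (x i - x j) <= C * \sum_k disagreement x k.
Proof.
have step i j : e i j -> exists C, forall x,
    dot (x i - x j) (x i - x j) <= C * \sum_k disagreement x k.
  move=> eij; have Aij : 0 < A j i by have [+ _] := A_adj j i; apply.
  exists (A j i)^-1 => x; rewrite ler_pdivlMl //.
  rewrite (bigD1 j) //= {1}/disagreement (bigD1 i) //= -addrA lerDl addr_ge0 //.
    by apply: sumr_ge0 => k _; rewrite mulr_ge0 ?adjacency_ge0 ?dot_ge0.
  by apply: sumr_ge0 => k _; exact: disagreement_ge0.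
have pairs (ij : 'I_N * 'I_N) : exists C, forall x,
    dot (x ij.1 - x ij.2) (x ij.1 - x ij.2) <= C * \sum_k disagreement x k.
  case: ij => i j /=; have /connectP[q] := e_conn i j.
  elim: q i => [|k q IHq] i /= => [_ ->|/andP[eik qk] jE].
    by exists 0 => x; rewrite subrr dot0l mul0r.
  have [C1 h1] := step i k eik; have [C2 h2] := IHq k qk jE.
  exists (2 * C1 + 2 * C2) => x.
  have -> : x i - x j = (x i - x k) + (x k - x j) by rewrite addrA subrK.
  by apply: le_trans (dot_sqrD _ _) _; have := h1 x; have := h2 x; lra.
have [C hC] := fin_all_exists pairs.
pose K := 1 + \sum_ij `|C ij|; exists K => [|x i j].
  by rewrite ltr_wpDr // sumr_ge0.
apply: le_trans (hC (i, j) x) _; rewrite ler_wpM2r //.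
  by apply: sumr_ge0 => k _; exact: disagreement_ge0.
rewrite /K (bigD1 (i, j)) //=; apply: le_trans (ler_norm _) _.
by rewrite addrCA lerDl addr_ge0 // sumr_ge0.
Qed.

Variables (f : 'I_N -> 'rV[R]_m -> R) (mu l : 'I_N -> R) (alpha : R) (z : 'rV[R]_m).
Hypotheses (alpha0 : 0 < alpha) (f_sc : forall i, strongly_convex (mu i) (f i)).
Hypothesis f_lip : forall i, lipschitz_grad (l i) (f i).

Lemma grad_lip_sqr i (p q : 'rV[R]_m) : dot (grad (f i) p - grad (f i) q) (grad (f i) p - grad (f i) q)
  <= l i ^+ 2 * dot (p - q) (p - q).
Proof.
rewrite -!sqr_norm2 -exprMn.
have := f_lip i p q => h.
rewrite ler_sqr ?nnegrE ?norm2_ge0 //.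
exact: le_trans (norm2_ge0 _) h.
Qed.

(** Strong convexity bounds the left side by the sum of [alpha h_i.(x_i - z)], where [h_i] is the
    difference of gradients. Splitting [x_i - z] at agent [i0] leaves differences [x_i - x_i0], and
    a common vector that meets only the sum of the [alpha h_i], that is, of the [y_i]. *)
Lemma error_bound (i0 : 'I_N) : exists2 C, 0 < C & forall x y,
  \sum_i y i = \sum_i alpha *: (grad (f i) (x i) - grad (f i) z) ->
  \sum_i dot (x i - z) (x i - z) <=
    C * (\sum_i dot (y i) (y i) + \sum_i disagreement x i).
Proof.
have [D D0 hD] := disagreement_pair.
have [mm mm0 hm] : exists2 c, 0 < c & forall i, c <= mu i.
  by apply: fin_lower_bound => i; case: (f_sc i).
have [L L0 hL] := fin_upper_bound (fun i => l i ^+ 2).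
pose n : R := N%:R; have n0 : 0 < n by rewrite ltr0n; case: (N) i0 => [[]|].
(* Each of the weights [s] and [s'] costs a quarter of [alpha mm P], so half of it survives. *)
pose s := mm / (2 * L); have s0 : 0 < s by rewrite divr_gt0 // mulr_gt0.
pose s' := alpha * mm / (2 * n); have s'0 : 0 < s' by rewrite divr_gt0 // mulr_gt0.
pose K := 2 / (alpha * mm) * (alpha / 2 * s^-1 * (n * D) + s'^-1 / 2).
have am0 : 0 < alpha * mm by rewrite mulr_gt0.
have K0 : 0 < K.
  by rewrite mulr_gt0 ?divr_gt0 // addr_gt0 // !(mulr_gt0, invr_gt0).
exists K => // x y hy.
set P := \sum_i dot (x i - z) (x i - z); set Y := \sum_i dot (y i) (y i).
set S := \sum_i disagreement x i.
pose h i := grad (f i) (x i) - grad (f i) z.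
pose p0 := x i0 - z.
have Y0 : 0 <= Y by apply: sumr_ge0 => i _; exact: dot_ge0.
have S0 : 0 <= S by apply: sumr_ge0 => i _; exact: disagreement_ge0.
have p0P : dot p0 p0 <= P.
  by rewrite /P (bigD1 i0) //= lerDl sumr_ge0 // => i _; exact: dot_ge0.
have lo : alpha * mm * P <= \sum_i alpha * dot (h i) (x i - z).
  rewrite -mulrA -mulr_sumr ler_pM2l // /P mulr_sumr; apply: ler_sum => i _.
  have [_ sc] := f_sc i; have := sc (x i) z; rewrite sqr_norm2 => sc'.
  apply: le_trans sc'; rewrite ler_wpM2r ?dot_ge0 //.
have E : \sum_i alpha * dot (h i) (x i - z) =
    \sum_i (alpha * dot (h i) (x i - x i0) + dot p0 (y i)).
  rewrite big_split /= -dot_sumr hy dot_sumr -big_split; apply: eq_bigr => i _ /=.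
  rewrite dotZr -/(h i) -mulrDr (dotC p0) -dotDr; congr (_ * dot _ _).
  by rewrite /p0 addrA subrK.
have up : \sum_i (alpha * dot (h i) (x i - x i0) + dot p0 (y i)) <=
   \sum_i (alpha / 2 * (s * (L * dot (x i - z) (x i - z)) + s^-1 * (D * S))
           + (s' * P + s'^-1 * dot (y i) (y i)) / 2).
  apply: ler_sum => i _.
  have y1 := young (h i) (x i - x i0) s0.
  have y2 := young p0 (y i) s'0.
  have y3 : dot (h i) (h i) <= L * dot (x i - z) (x i - z).
    by apply: le_trans (grad_lip_sqr i _ _) _; rewrite ler_wpM2r ?dot_ge0.
  have y4 := hD x i i0; rewrite -/S in y4.
  have y5 := ler_wpM2l (ltW s0) y3.
  have si : 0 <= s^-1 by rewrite invr_ge0 ltW.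
  have y6 := ler_wpM2l si y4.
  have y7 := ler_wpM2l (ltW s'0) p0P.
  have y8 : alpha * dot (h i) (x i - x i0) <=
     alpha / 2 * (s * (L * dot (x i - z) (x i - z)) + s^-1 * (D * S)).
    by rewrite -mulrA ler_pM2l //; lra.
  by apply: lerD => //; lra.
have R1 : \sum_i (alpha / 2 * (s * (L * dot (x i - z) (x i - z)) + s^-1 * (D * S))
           + (s' * P + s'^-1 * dot (y i) (y i)) / 2) =
   alpha / 2 * (s * L * P + n * (s^-1 * (D * S))) + (n * (s' * P) + s'^-1 * Y) / 2.
  have sc (c : R) : \sum_(i < N) c = n * c by rewrite sumr_const card_ord mulr_natl.
  by rewrite big_split /= -mulr_sumr -mulr_suml !big_split /= !sc -!mulr_sumr mulrA.
have R2 : alpha / 2 * (s * L * P) = alpha * mm * P / 4.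
  by rewrite /s; field; rewrite gt_eqF.
have R3 : n * (s' * P) / 2 = alpha * mm * P / 4.
  by rewrite /s'; field; rewrite gt_eqF.
have fin : alpha * mm / 2 * P <= (alpha / 2 * s^-1 * (n * D) + s'^-1 / 2) * (Y + S).
  have : 0 <= alpha / 2 * s^-1 * (n * D) * Y.
    by rewrite !mulr_ge0 // ?invr_ge0 // ltW.
  have : 0 <= s'^-1 / 2 * S by rewrite !mulr_ge0 // ?invr_ge0 // ltW.
  by move: lo up; rewrite E R1; move: R2 R3; lra.
have am2 : 0 < alpha * mm / 2 by rewrite divr_gt0.
rewrite -(ler_pM2l am2); apply: le_trans fin _.
rewrite le_eqVlt; apply/orP; left; apply/eqP; rewrite /K.
by field; rewrite !gt_eqF.
Qed.

End Network.

(** * Exponential convergence *)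

Section StateError.
Variables (R : realType) (N m : nat).
Implicit Types x : 'I_N -> 'rV[R]_m.

Lemma stack_sqr x x' :
  dot (stack x - stack x') (stack x - stack x') = \sum_i dot (x i - x' i) (x i - x' i).
Proof.
rewrite /stack -linearB /= [LHS](reindex _ (curry_mxvec_bij _ _)) /=.
rewrite pair_bigA /=; apply: eq_bigr => -[i j] _ /=.
by rewrite mxvecE !mxE.
Qed.

Lemma state_error_sqr x lam x' lam' : state_error x lam x' lam' ^+ 2 =
  \sum_i dot (x i - x' i) (x i - x' i) + \sum_i dot (lam i - lam' i) (lam i - lam' i).
Proof.
rewrite sqr_norm2 -!stack_sqr {1}/dot big_split_ord /=.
by congr (_ + _); apply: eq_bigr => k _; rewrite ?row_mxEl ?row_mxEr.
Qed.

Lemma state_error_ge0 x lam x' lam' : 0 <= state_error x lam x' lam'.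
Proof. exact: norm2_ge0. Qed.

End StateError.

Section Minimizer.
Variables (R : realType) (N m : nat) (f : 'I_N -> 'rV[R]_m -> R).

(** Along the direction [v] of the gradient itself, the derivative at the minimizer is [|v|^2]. *)
Lemma minimizer_grad (z : 'rV[R]_m) : (forall i x, differentiable (f i) x) ->
  minimizer (fun y => \sum_i f i y) z -> \sum_i grad (f i) z = 0.
Proof.
move=> df hz; set v := \sum_i _; apply: dot_eq0.
pose phi (t : R) := \sum_i f i (z + t *: v).
have hphi (t : R) : is_derive t 1 phi (\sum_i dot (grad (f i) (z + t *: v)) v).
  have h (i : 'I_N) : is_derive t 1 (fun s : R => f i (z + s *: v)) (dot (grad (f i) (z + t *: v)) v).
    by apply: is_derive_along => //; exact: is_derive_line.
  by have := is_derive_sum h; rewrite fct_sumE.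
have m11 : (-1 : R) <= 1 by lra.
have h0 : (0 : R) \in `]-1, 1[ by rewrite in_itv /= ltrN10 ltr01.
have hmin (t : R) : t \in `]-1, 1[ -> phi 0 <= phi t.
  by move=> _; rewrite /phi scale0r addr0; exact: hz.
have := derive1_at_min m11 (fun t _ => @ex_derive _ _ _ _ _ _ _ (hphi t)) h0 hmin.
move=> /(@derive_val _ _ _ _ _ _ _); have := @derive_val _ _ _ _ _ _ _ (hphi 0) => -> .
by rewrite scale0r addr0 -dot_suml.
Qed.

End Minimizer.

(** * A Lyapunov function for the network *)

Section Lyapunov.
Local Open Scope classical_set_scope.
Variables (R : realType) (N m : nat) (f : 'I_N -> 'rV[R]_m -> R) (mu l : 'I_N -> R).
Variables (e : rel 'I_N) (A : 'M[R]_N) (alpha beta gamma sigma_min : R).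
Variables (z : 'rV[R]_m) (i0 : 'I_N) (v0 : 'rV[R]_m).
Hypotheses (f_C2 : forall i, C2 (f i)) (f_sc : forall i, strongly_convex (mu i) (f i)).
Hypotheses (f_lip : forall i, lipschitz_grad (l i) (f i)).
Hypotheses (A_adj : adjacency e A) (e_conn : strongly_connected e).
Hypotheses (A_bal : weight_balanced A) (alpha0 : 0 < alpha) (gamma0 : 0 < gamma).
Hypotheses (s0 : 0 < sigma_min) (v0_neq0 : v0 != 0).
Hypothesis grad_z : \sum_i grad (f i) z = 0.

Let r i := `|ifp_index alpha beta gamma (mu i) (f i)|.

(** Squared distance to equilibrium in the coordinates [x_i - z] and [y_i] of the storage functions,
    all of which vanish there. *)
Definition energy (x lam : 'I_N -> 'rV[R]_m) : R :=
  \sum_i (dot (x i - z) (x i - z)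
    + dot (alpha *: grad (f i) (x i) + lam i) (alpha *: grad (f i) (x i) + lam i)).

(** The gain condition only yields [U <= s / 2 S], which the undisturbed part of the coupling term
    just compensates; the decay comes from the surplus [d] and from [Z]. The gain [s] is quantified
    after [eps], so the rate is uniform in time. *)
Lemma lyapunov : exists (W : ('I_N -> 'rV[R]_m) -> ('I_N -> 'rV[R]_m) -> R) (k1 k2 eps : R),
  [/\ 0 < k1, 0 < k2 & 0 < eps] /\
  [/\ (forall x lam, k1 * energy x lam <= W x lam),
      (forall x lam, W x lam <= k2 * energy x lam),
      (forall (T : Type) (F : set_system T) (FF : Filter F) (X L : T -> 'I_N -> 'rV[R]_m) x lam,
         (forall i, X t i @[t --> F] --> x i) -> (forall i, L t i @[t --> F] --> lam i) ->
         W (X t) (L t) @[t --> F] --> W x lam) &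
      forall (X L : R -> 'I_N -> 'rV[R]_m) (t s : R), sigma_min <= s ->
        (forall i, s * r i * in_degree A i <= 1 / 2) ->
        \sum_i L t i = 0 ->
        (forall i, is_derive t 1 (fun s => X s i)
          (- alpha *: grad (f i) (X t i) - L t i + beta *: coupling A s (X t) i)) ->
        (forall i, is_derive t 1 (fun s => L s i) (- gamma *: coupling A s (X t) i)) ->
        exists2 dW, is_derive t 1 (fun s => W (X s) (L s)) dW & dW <= - eps * W (X t) (L t)].
Proof.
have [B B0 hB] := error_bound A_adj e_conn z alpha0 f_sc f_lip i0.
have storage i := agent_storage beta alpha0 gamma0 v0_neq0 (f_C2 i) (f_lip i) (f_sc i) z.
have [om om_ex] := choice storage; have [cc cc_ex] := choice om_ex.
have [CC hp] := choice cc_ex.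
have [c c0 hc] : exists2 c, 0 < c & forall i, c <= cc i.
  by apply: fin_lower_bound => i; case: (hp i).
have [C C0 hC] := fin_upper_bound CC.
(* For [r i = 0] the quotient is 0 by convention; [omr] then holds because [om i = 0]. *)
have [D D0 hD] := fin_upper_bound (fun i => om i ^+ 2 / r i).
have r0 i : 0 <= r i by exact: normr_ge0.
have omr i : om i ^+ 2 <= D * r i.
  have [rz|rn] := eqVneq (r i) 0.
    have [h _ _ _] := hp i; have {}h : om i = 0 by exact: h.
    by rewrite h expr0n mulr_ge0 // ltW.
  have rp : 0 < r i by rewrite lt_def rn r0.
  by rewrite -ler_pdivrMr.
(* [G] is made for the estimate [P + Y <= G (Z + s S)], and [d] below is so small that the error
   [C d^2 P] costs at most [d / 4] of [Z + s S]. *)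
pose G := B * (D + sigma_min^-1 + 2) + D + 2.
have si0 : 0 < sigma_min^-1 by rewrite invr_gt0.
have G0 : 0 < G by rewrite !addr_gt0 // mulr_gt0 // !addr_gt0.
have CG0 : 0 < C * G by rewrite mulr_gt0.
pose d := Num.min c (4 * (C * G))^-1.
have d0 : 0 < d by rewrite lt_min c0 invr_gt0 mulr_gt0.
have dc : d <= c by rewrite ge_min lexx.
have dG : C * G * d ^+ 2 <= d / 4.
  have h : 4 * (C * G) * d <= 1.
    by rewrite -ler_pdivlMl ?mulr_gt0 // mulr1 ge_min lexx orbT.
  by have := ler_wpM2r (ltW d0) h; rewrite expr2; lra.
have storage2 i := let: And4 _ _ _ h := hp i in h d d0.
have [w w_ex] := choice storage2; have [kk1 kk1_ex] := choice w_ex.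
have [kk2 hq] := choice kk1_ex.
have [k1 k10 hk1] : exists2 c, 0 < c & forall i, c <= kk1 i.
  by apply: fin_lower_bound => i; case: (hq i).
have [k2 k20 hk2] := fin_upper_bound kk2.
pose W (x lam : 'I_N -> 'rV[R]_m) := \sum_i w i (x i) (lam i).
pose eps := d / 4 / (G * k2).
have eps0 : 0 < eps by rewrite !divr_gt0 // mulr_gt0.
have lowW x lam : k1 * energy x lam <= W x lam.
  rewrite /energy mulr_sumr; apply: ler_sum => i _; have [_ [h _ _ _]] := hq i.
  apply: le_trans (h _ _); rewrite ler_wpM2r // addr_ge0 // dot_ge0 //.
have upW x lam : W x lam <= k2 * energy x lam.
  rewrite /energy mulr_sumr; apply: ler_sum => i _; have [_ [_ h _ _]] := hq i.
  apply: le_trans (h _ _) _; rewrite ler_wpM2r // addr_ge0 // dot_ge0 //.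
exists W, k1, k2, eps; split=> //; split=> //.
  move=> T F FF X L x lam hX hL; apply: cvg_big => [|i _]; first exact: add_continuous.
  by have [_ [_ _ h _]] := hq i; exact: h.
move=> X L t s ss hs L0 dX dL.
have sp : 0 < s by exact: lt_le_trans ss.
pose u := coupling A s (X t).
pose y i := alpha *: grad (f i) (X t i) + L t i.
have dWi i : exists dW, is_derive t 1 (fun s => w i (X s i) (L s i)) dW /\
   dW <= (1 + d) * dot (X t i - z) (u i) + r i * dot (u i) (u i)
            - c * dot (y i - om i *: u i) (y i - om i *: u i)
            + C * d ^+ 2 * dot (X t i - z) (X t i - z).
  have [_ [_ _ _ h]] := hq i; have [dW h1 h2] := h _ _ _ _ (dX i) (dL i).
  exists dW; split=> //; apply: le_trans h2 _.
  apply: lerD; last by rewrite !ler_wpM2r ?sqr_ge0 ?dot_ge0.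
  by rewrite lerD2l lerN2 ler_wpM2r ?dot_ge0.
have [dW hdW] := fin_all_exists dWi.
exists (\sum_i dW i).
  have := is_derive_sum (fun i => (hdW i).1); rewrite fct_sumE; exact.
pose S := \sum_i disagreement A (X t) i.
pose U := \sum_i r i * dot (u i) (u i).
pose Z := \sum_i dot (y i - om i *: u i) (y i - om i *: u i).
pose P := \sum_i dot (X t i - z) (X t i - z).
pose Y := \sum_i dot (y i) (y i).
have S0 : 0 <= S by apply: sumr_ge0 => i _; exact: disagreement_ge0.
have Z0 : 0 <= Z by apply: sumr_ge0 => i _; exact: dot_ge0.
have h1 : \sum_i dW i <= (1 + d) * (- (s / 2) * S) + U - c * Z + C * d ^+ 2 * P.
  rewrite -(sum_dot_coupling A_bal s (X t) z) /U /Z /P !mulr_sumr -big_split -sumrB -big_split /=.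
  by apply: ler_sum => i _; exact: (hdW i).2.
have hU : U <= s / 2 * S.
  rewrite /U /S mulr_sumr; apply: ler_sum => i _.
  have di0 : 0 <= disagreement A (X t) i by exact: disagreement_ge0.
  apply: le_trans (ler_wpM2l (r0 i) (coupling_le A_adj s (X t) i)) _.
  have := ler_wpM2r (mulr_ge0 (ltW sp) di0) (hs i).
  by rewrite expr2; lra.
have hY : Y <= 2 * Z + 2 * D * U.
  rewrite /Y /Z /U !mulr_sumr -big_split /=; apply: ler_sum => i _.
  have := dot_sqrD (y i - om i *: u i) (om i *: u i); rewrite subrK.
  rewrite [dot (om i *: u i) _]dotZl [dot (u i) (_ *: _)]dotZr.
  have := ler_wpM2r (dot_ge0 (u i)) (omr i); rewrite expr2; lra.
have hP : P <= B * (Y + S).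
  apply: hB; rewrite big_split /= L0 addr0 -scaler_sumr -scaler_sumr.
  by rewrite sumrB grad_z subr0.
have hS : S <= sigma_min^-1 * (s * S).
  rewrite mulrA ler_peMl // ler_pdivlMl // mulr1 //.
have sS0 : 0 <= s * S by rewrite mulr_ge0 // ltW.
have hE : P + Y <= G * (Z + s * S).
  have hY2 : Y <= 2 * Z + D * (s * S).
    by have := ler_wpM2l (ltW D0) hU; lra.
  have b1 := ler_wpM2l (ltW B0) hY2.
  have b2 := ler_wpM2l (ltW B0) hS.
  have b3 : 0 <= B * (D + sigma_min^-1) * Z by rewrite !mulr_ge0 ?addr_ge0 // ltW.
  have b4 : 0 <= B * (s * S) by rewrite mulr_ge0 // ltW.
  have b5 : 0 <= D * Z by rewrite mulr_ge0 // ltW.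
  by rewrite /G; lra.
have EPY : energy (X t) (L t) = P + Y by rewrite /energy big_split.
have P0 : 0 <= P by apply: sumr_ge0 => i _; exact: dot_ge0.
have Y0 : 0 <= Y by apply: sumr_ge0 => i _; exact: dot_ge0.
have h2 : C * d ^+ 2 * P <= d / 4 * (Z + s * S).
  have a1 : P <= G * (Z + s * S) by lra.
  have Cd : 0 <= C * d ^+ 2 by rewrite mulr_ge0 ?sqr_ge0 // ltW.
  apply: le_trans (ler_wpM2l Cd a1) _.
  have ZS : 0 <= Z + s * S by rewrite addr_ge0.
  by have := ler_wpM2r ZS dG; lra.
have h3 : \sum_i dW i <= - (d / 4) * (Z + s * S).
  have : d * Z <= c * Z by rewrite ler_wpM2r.
  have : 0 <= d * Z by rewrite mulr_ge0 // ltW.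
  by move: h1 hU h2; lra.
apply: le_trans h3 _; rewrite !mulNr lerN2.
have := upW (X t) (L t); rewrite EPY => h4.
apply: le_trans (ler_wpM2l (ltW eps0) h4) _.
have := ler_wpM2l (ltW eps0) (ler_wpM2l (ltW k20) hE).
move/le_trans; apply; rewrite /eps le_eqVlt; apply/orP; left; apply/eqP.
by field; rewrite !gt_eqF.
Qed.

End Lyapunov.

(** * Decay and conservation along solutions *)

Section Decay.
Variable R : realType.
Local Open Scope classical_set_scope.

(** The product of [g] with [expR (eps * t)] has nonpositive derivative off [D]. *)
Lemma exponential_decay (g : R -> R) (eps : R) (D : set R) :
  {within `[0, +oo[, continuous g} -> countable D ->
  (forall t, 0 < t -> ~ D t -> exists2 dg, is_derive t 1 g dg & dg <= - eps * g t) ->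
  forall t, 0 <= t -> g t <= g 0 * expR (- eps * t).
Proof.
move=> cg cD dg t t0.
have dE (s : R) : is_derive s 1 (fun s => expR (eps * s)) (expR (eps * s) * eps).
  have h : is_derive s 1 (fun s : R => eps *: s) (eps *: 1) by exact: is_deriveZ.
  have dexp : differentiable (@expR R) (eps *: s) by exact/derivable1_diffP.
  have := is_derive_comp_diff dexp h.
  have [d1 dv] := is_derive_expR (eps *: s).
  by rewrite (deriv1E d1) derive1E dv [eps *: 1]mulr1 [_ *: expR _]mulrC.
have cE : continuous (fun s : R => expR (eps * s)).
  move=> s; apply: (continuous_comp (f := fun s : R => eps * s)).
    exact: mulrl_continuous.
  exact: continuous_expR.
have h := @nonincreasing_countable R (fun s => g s * expR (eps * s)) D.
have := h _ cD _ t t0; rewrite mulr0 expR0 mulr1 mulNr expRN.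
rewrite ler_pdivlMr ?expR_gt0 //; apply.
  move=> s; apply: cvgM; first exact: cg.
  by apply: continuous_subspaceT; exact: cE.
move=> s s0 Ds; have [d hd dle] := dg s s0 Ds.
exists (g s *: (expR (eps * s) * eps) + expR (eps * s) *: d); first exact: is_deriveM.
have -> : g s *: (expR (eps * s) * eps) + expR (eps * s) *: d = expR (eps * s) * (d + eps * g s).
  by rewrite /GRing.scale /=; ring.
by rewrite pmulr_rle0 ?expR_gt0 //; lra.
Qed.

(** By balance the couplings sum to zero, so each coordinate of the sum, and its opposite, has
    derivative zero off a countable set. *)
Lemma sum_lambda_invariant (N m : nat) (f : 'I_N -> 'rV[R]_m -> R) (A : 'M[R]_N)
    (alpha beta gamma : R) (sigma : R -> R) (x lambda : R -> 'I_N -> 'rV[R]_m) :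
  weight_balanced A -> solution f A alpha beta gamma sigma x lambda ->
  \sum_i lambda 0 i = 0 -> forall t, 0 <= t -> \sum_i lambda t i = 0.
Proof.
move=> A_bal [_ cl [D cD hD]] l0 t t0; apply/rowP => k; rewrite mxE.
pose g s := (\sum_i lambda s i) 0 k.
have dg s : 0 < s -> ~ D s -> is_derive s 1 g 0.
  move=> s0 Ds.
  have h (i : 'I_N) := (hD s s0 Ds i).2.
  have := is_derive_sum h; rewrite fct_sumE => hs.
  apply: is_derive_eq (is_derive_coord k hs) _.
  by rewrite -scaler_sumr sum_coupling // scaler0 mxE.
have cg : {within `[0, +oo[, continuous g}.
  move=> s; apply: cvg_coord; apply: cvg_big => [|i _]; first exact: add_continuous.
  exact: cl.
have g0 : g 0 = 0 by rewrite /g l0 mxE.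
apply/eqP; rewrite eq_le -/(g t); apply/andP; split.
  rewrite -g0; apply: (nonincreasing_countable cg cD) => // s s0 Ds.
  by exists 0 => //; exact: dg.
suff : - g t <= - g 0 by rewrite g0 lerN2.
apply: (@nonincreasing_countable R (fun s => - g s) D) => //.
  by move=> s; apply: cvgN; exact: cg.
by move=> s s0 Ds; exists 0 => //; rewrite -[0]oppr0; apply: is_deriveN; exact: dg.
Qed.

End Decay.

Section EnergyError.
Variables (R : realType) (N m : nat) (f : 'I_N -> 'rV[R]_m -> R) (l : 'I_N -> R).
Variables (alpha : R) (z : 'rV[R]_m) (xstar lstar : 'I_N -> 'rV[R]_m).
Hypothesis f_lip : forall i, lipschitz_grad (l i) (f i).
Hypotheses (xE : forall i, xstar i = z).
Hypothesis lE : forall i, lstar i = - alpha *: grad (f i) (xstar i).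

(** [y_i] and [lam_i - lstar_i] differ by [alpha] times a difference of gradients, which the
    Lipschitz condition compares with [x_i - z]. *)
Lemma energy_error : exists2 K, 0 < K & forall x lam,
  state_error x lam xstar lstar ^+ 2 <= K * energy f alpha z x lam /\
  energy f alpha z x lam <= K * state_error x lam xstar lstar ^+ 2.
Proof.
have [L L0 hL] := fin_upper_bound (fun i => l i ^+ 2).
pose b := alpha ^+ 2 * L; have b0 : 0 <= b by rewrite mulr_ge0 ?sqr_ge0 // ltW.
exists (3 + 2 * b) => [|x lam]; first by lra.
pose y i := alpha *: grad (f i) (x i) + lam i.
pose v i := lam i - lstar i; pose h i := alpha *: (grad (f i) (x i) - grad (f i) z).
have yE i : y i = v i + h i.
  by rewrite /v /h lE xE scalerBr scaleNr opprK addrACA subrr addr0 addrC.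
have vE i : v i = y i - h i by rewrite yE addrK.
have hh i : dot (h i) (h i) <= b * dot (x i - z) (x i - z).
  rewrite dotZl dotZr mulrA -expr2 /b -mulrA ler_wpM2l ?sqr_ge0 //.
  by apply: le_trans (grad_lip_sqr f_lip _ _ _) _; rewrite ler_wpM2r ?dot_ge0.
rewrite state_error_sqr /energy -big_split /= !mulr_sumr.
split; apply: ler_sum => i _; rewrite xE -/(v i) -/(y i);
  set P := dot (x i - z) _; have P0 : 0 <= P by exact: dot_ge0.
  have := dot_sqrB (y i) (h i); rewrite -vE => h1.
  have Y0 := dot_ge0 (y i); have h2 := hh i; rewrite -/P in h2.
  have : 0 <= b * dot (y i) (y i) by rewrite mulr_ge0.
  have : 0 <= b * P by rewrite mulr_ge0.
  by lra.
have := dot_sqrD (v i) (h i); rewrite -yE => h1.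
have Y0 := dot_ge0 (v i); have h2 := hh i; rewrite -/P in h2.
have : 0 <= b * dot (v i) (v i) by rewrite mulr_ge0.
have : 0 <= b * P by rewrite mulr_ge0.
by lra.
Qed.

End EnergyError.

Unset Implicit Arguments.

Theorem theorem3 (R : realType) (N m : nat)
    (f : 'I_N -> 'rV[R]_m -> R) (mu l : 'I_N -> R)
    (e : rel 'I_N) (A : 'M[R]_N)
    (alpha beta gamma : R) (sigma : R -> R) (sigma_min : R)
    (xstar lstar : 'I_N -> 'rV[R]_m)
    (f_C2 : forall i, C2 (f i))
    (f_strongly_convex : forall i, strongly_convex (mu i) (f i))
    (f_lipschitz : forall i, lipschitz_grad (l i) (f i))
    (no_self_loops : irreflexive e)
    (A_adjacency : adjacency e A)
    (G_strongly_connected : strongly_connected e)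
    (G_weight_balanced : weight_balanced A)
    (L_neq0 : laplacian A != 0)
    (alpha_gt0 : 0 < alpha) (gamma_gt0 : 0 < gamma)
    (sigma_min_gt0 : 0 < sigma_min)
    (sigma_ge : forall t : R, 0 <= t -> sigma_min <= sigma t)
    (sigma_cond : forall t : R, 0 <= t -> forall i,
       0 < 1 / 2 - sigma t * `|ifp_index alpha beta gamma (mu i) (f i)|
                   * in_degree A i)
    (optimal : optimal_point f alpha xstar lstar) :
  exists c eps : R, [/\ 0 < c, 0 < eps &
    forall x lambda : R -> 'I_N -> 'rV[R]_m,
      solution f A alpha beta gamma sigma x lambda ->
      \sum_i lambda 0 i = 0 ->
      forall t : R, 0 <= t ->
        state_error (x t) (lambda t) xstar lstar
          <= c * state_error (x 0) (lambda 0) xstar lstar * expR (- eps * t)].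
Proof.
have [i0|noN] := pickP (fun _ : 'I_N => true); last first.
  by move: L_neq0; case/negP; apply/eqP/matrixP => i; have := noN i.
(* In dimension 0 there is no nonzero vector on which to test the Hessian bounds, but every error is
   0. *)
have [k0 _|nom] := pickP (fun _ : 'I_m => true); last first.
  exists 1, 1; split=> // x lambda _ _ t _.
  have err0 u v : state_error u v xstar lstar = 0.
    apply/eqP; rewrite -sqrf_eq0 state_error_sqr.
    have dz (w : 'rV[R]_m) : dot w w = 0 by apply: big1 => k _; have := nom k.
    by rewrite !big1 ?addr0 // => i _; exact: dz.
  by rewrite !err0 mulr0 mul0r.
have [z [zmin xE lE]] := optimal.
pose v0 : 'rV[R]_m := delta_mx 0 k0.
have v0_neq0 : v0 != 0.
  by apply/eqP => /rowP/(_ k0)/eqP; rewrite !mxE !eqxx oner_eq0.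
have gz : \sum_i grad (f i) z = 0.
  by apply: minimizer_grad zmin => i x; case: (f_C2 i) => /(_ x).
have [W [k1 [k2 [eps [[k10 k20 eps0] [lo up cW dW]]]]]] :=
  lyapunov beta i0 f_C2 f_strongly_convex f_lipschitz A_adjacency
    G_strongly_connected G_weight_balanced alpha_gt0 gamma_gt0 sigma_min_gt0 v0_neq0 gz.
have [K K0 hK] := energy_error f_lipschitz xE lE.
pose c2 := K / k1 * (k2 * K).
have c20 : 0 < c2 by rewrite !(mulr_gt0, invr_gt0).
(* The Lyapunov function compares with the square of the error, hence the square root and the halved
   rate. *)
exists (Num.sqrt c2), (eps / 2); split; rewrite ?sqrtr_gt0 ?divr_gt0 //.
move=> x lambda sol l0 t t0.
have [cx cl [D cD hD]] := sol.
have dec : W (x t) (lambda t) <= W (x 0) (lambda 0) * expR (- eps * t).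
  apply: (exponential_decay (g := fun s => W (x s) (lambda s)) _ cD) => //.
    by move=> s; apply: cW; [move=> j; exact: cx | move=> j; exact: cl].
  move=> s s0 Ds; have s0' := ltW s0.
  apply: (dW _ _ _ (sigma s)).
  - exact: sigma_ge.
  - by move=> j; have := sigma_cond s s0' j; rewrite subr_gt0 => /ltW.
  - exact: (sum_lambda_invariant G_weight_balanced sol).
  - by move=> j; have [] := hD s s0 Ds j.
  - by move=> j; have [] := hD s s0 Ds j.
have E2 : expR (- eps * t) = expR (- (eps / 2) * t) ^+ 2.
  by rewrite expr2 -expRD; congr expR; field.
rewrite -ler_sqr ?nnegrE ?state_error_ge0 //; last first.
  by rewrite !mulr_ge0 ?sqrtr_ge0 ?state_error_ge0 ?expR_ge0.
rewrite !exprMn [Num.sqrt c2 ^+ 2]sqr_sqrtr ?(ltW c20) // -E2.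
have [h1 _] := hK (x t) (lambda t); have [_ h2] := hK (x 0) (lambda 0).
apply: le_trans h1 _.
have e1 : energy f alpha z (x t) (lambda t) <= k1^-1 * W (x t) (lambda t).
  by rewrite ler_pdivlMl.
have e2 := ler_wpM2r (expR_ge0 (- eps * t)) (le_trans (up (x 0) (lambda 0)) (ler_wpM2l (ltW k20) h2)).
have e3 := le_trans dec e2.
have ki : 0 <= k1^-1 by rewrite invr_ge0 ltW.
have := ler_wpM2l (ltW K0) (le_trans e1 (ler_wpM2l ki e3)).
by rewrite /c2; lra.
Qed.
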